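(* For a finite set of places $S\subset\Sigma_{\mathbb Q}$ with $\infty\in S$, let $\mathcal S(\mathbb A_S)$ denote the Bruhat-Schwartz space of functions on $\mathbb A_S$. (1) For any pair of finite sets $\infty\in S\subset S'\subset\Sigma_{\mathbb Q}$, let $R_{S',S}$ be the maximal compact subring of $\prod_{v\in S'\setminus S}\mathbb Q_v$. Then the natural maps $$\gamma(S,S'):\mathcal S(\mathbb A_S)\to\mathcal S(\mathbb A_{S'}),\qquad f\mapsto 1_{R_{S',S}}\otimes f$$ define a sheaf $\mathscr O$ of algebras on $\mathrm{Spec}\,\mathbb Z$. (2) The stalk of the sheaf $\mathscr O$ at the generic point $\eta\in\mathrm{Spec}\,\mathbb Z$ is the Bruhat-Schwartz algebra of functions on $\mathbb A_{\mathbb Q}$. (3) The global sections $\Gamma(\mathrm{Spec}\,\mathbb Z,\mathscr O)$ form the Schwartz space $\mathcal S(\mathbb R)=\mathcal S(\mathbb A_{\{\infty\}})$.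
   Context: $\Sigma_{\mathbb Q}$ is the set of places of $\mathbb Q$ and $\mathbb A_S=\prod_{v\in S}\mathbb Q_v$. Bruhat-Schwartz functions on $\mathbb R$ are the Schwartz functions; on $\mathbb Q_p$ they are the locally constant compactly supported functions; those on $\mathbb A_S$ are finite linear combinations of products $\otimes_{v\in S}f_v$, and those on $\mathbb A_{\mathbb Q}$ are finite linear combinations of products $\otimes_vf_v$ with $f_v\in\mathcal S(\mathbb Q_v)$ and $f_v=1_{\mathbb Z_v}$ for all but finitely many $v$. They form algebras under pointwise product. The non-empty Zariski open subsets of $\mathrm{Spec}\,\mathbb Z$ are the complements $S^c$ of the sets of closed points corresponding to $S\setminus\{\infty\}$, for $S\ni\infty$ a finite set of places; hence a covariant functor on finite sets $S\ni\infty$ ordered by inclusion is a presheaf on $\mathrm{Spec}\,\mathbb Z$, with $\mathscr O(S^c)=\mathcal S(\mathbb A_S)$ and restriction maps $\gamma(S,S')$. *)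

(* Defs.v *)
From HB Require Import structures.
From mathcomp Require Import all_boot all_order all_algebra finmap ring_quotient.
From mathcomp Require Import all_classical all_reals all_analysis complex.

Set Implicit Arguments.
Unset Strict Implicit.
Unset Printing Implicit Defensive.

Import Order.TTheory GRing.Theory Num.Theory.
Import numFieldNormedType.Exports.

Local Open Scope classical_set_scope.
Local Open Scope ring_scope.
Local Open Scope quotient_scope.

Definition prime_number := {p : nat | prime p}.

Section padic_abs.
Variable p : prime_number.
Implicit Types (a b : int) (q r : rat).

Let pr : prime (val p) := valP p.

Let p_gt0 : 0 < (val p)%:R :> rat.
Proof. by rewrite ltr0n prime_gt0. Qed.

Let p_neq0 : (val p)%:R != 0 :> rat.
Proof. by rewrite gt_eqF. Qed.

Let p_ge1 : 1 <= (val p)%:R :> rat.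
Proof. by rewrite ler1n prime_gt0. Qed.

Definition padic_val q : int :=
  (logn (val p) `|numq q|)%:Z - (logn (val p) `|denq q|)%:Z.

Definition padic_abs q : rat :=
  if q == 0 then 0 else (val p)%:R ^ (- padic_val q).

Let vz a : nat := logn (val p) `|a|.

Let vzM a b : a != 0 -> b != 0 -> vz (a * b) = (vz a + vz b)%N.
Proof. by move=> a0 b0; rewrite /vz abszM lognM// absz_gt0. Qed.

Lemma padic_absE a b : a != 0 -> b != 0 ->
  padic_abs (a%:~R / b%:~R) = (val p)%:R ^ ((vz b)%:Z - (vz a)%:Z).
Proof.
move=> a0 b0; set q : rat := a%:~R / b%:~R.
have q0 : q != 0 by rewrite mulf_neq0 ?invr_eq0 ?intr_eq0.
rewrite /padic_abs (negbTE q0) /padic_val opprB; congr (_ ^ _).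
have e : numq q * b = a * denq q.
  apply/eqP; rewrite -(@eqr_int rat) !rmorphM /= numqE /q.
  by rewrite mulrAC divfK ?intr_eq0.
have n0 : numq q != 0 by rewrite numq_eq0.
have := congr1 vz e; rewrite !vzM// ?denq_neq0// -/(vz (denq q)) -/(vz (numq q)).
move=> {}e; have {e} := congr1 Posz e; rewrite !PoszD => e.
apply/eqP; rewrite subr_eq addrAC eq_sym subr_eq; apply/eqP.
by rewrite [in RHS]addrC -e addrC.
Qed.

Lemma padic_abs0 : padic_abs 0 = 0. Proof. by rewrite /padic_abs eqxx. Qed.

Lemma padic_abs_gt0 q : q != 0 -> 0 < padic_abs q.
Proof. by move=> q0; rewrite /padic_abs (negbTE q0) exprz_gt0. Qed.

Lemma padic_abs_ge0 q : 0 <= padic_abs q.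
Proof.
have [->|/padic_abs_gt0/ltW//] := eqVneq q 0; by rewrite padic_abs0.
Qed.

Lemma padic_abs1 : padic_abs 1 = 1.
Proof.
have -> : 1 = 1%:~R / 1%:~R :> rat by rewrite divr1.
by rewrite padic_absE// subrr.
Qed.

Lemma padic_absN q : padic_abs (- q) = padic_abs q.
Proof. by rewrite /padic_abs oppr_eq0 /padic_val numqN denqN abszN. Qed.

Lemma padic_absM q r : padic_abs (q * r) = padic_abs q * padic_abs r.
Proof.
have [->|q0] := eqVneq q 0; first by rewrite mul0r padic_abs0 mul0r.
have [->|r0] := eqVneq r 0; first by rewrite mulr0 padic_abs0 mulr0.
rewrite -(divq_num_den q) -(divq_num_den r) mulf_div -!rmorphM/=.
rewrite !padic_absE ?mulf_neq0 ?denq_neq0 ?numq_eq0// -expfzDr//.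
by congr (_ ^ _); rewrite !vzM ?denq_neq0 ?numq_eq0// !PoszD opprD addrACA.
Qed.

Let vzD a b : a + b != 0 -> a != 0 -> b != 0 ->
  (minn (vz a) (vz b) <= vz (a + b))%N.
Proof.
move=> ab0 a0 b0; rewrite /vz -pfactor_dvdn ?absz_gt0//.
have dv c : c != 0 -> (minn (vz a) (vz b) <= vz c)%N ->
    ((val p ^ minn (vz a) (vz b))%N%:Z %| c)%Z.
  by move=> c0; rewrite /vz -pfactor_dvdn ?absz_gt0// dvdzE.
have := rpredD (dv _ a0 (geq_minl _ _)) (dv _ b0 (geq_minr _ _)).
by rewrite dvdzE.
Qed.

Lemma padic_absD q r :
  padic_abs (q + r) <= Num.max (padic_abs q) (padic_abs r).
Proof.
have [->|q0] := eqVneq q 0.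
  by rewrite add0r le_max lexx orbT.
have [->|r0] := eqVneq r 0.
  by rewrite addr0 le_max lexx.
have [->|s0] := eqVneq (q + r) 0.
  by rewrite padic_abs0 le_max padic_abs_ge0.
have d0 : denq q * denq r != 0 by rewrite mulf_neq0// denq_neq0.
have a0 : numq q * denq r != 0 by rewrite mulf_neq0 ?numq_eq0 ?denq_neq0.
have b0 : numq r * denq q != 0 by rewrite mulf_neq0 ?numq_eq0 ?denq_neq0.
have qE : q = (numq q * denq r)%:~R / (denq q * denq r)%:~R.
  by rewrite !rmorphM/= -mulf_div divff ?intr_eq0 ?denq_neq0// mulr1 divq_num_den.
have rE : r = (numq r * denq q)%:~R / (denq q * denq r)%:~R.
  rewrite !rmorphM/= [(denq q)%:~R * _]mulrC.
  by rewrite -mulf_div divff ?intr_eq0 ?denq_neq0// mulr1 divq_num_den.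
move: (numq q * _) (numq r * _) (denq q * _) a0 b0 d0 qE rE => a b d.
move=> a0 b0 d0 qE rE; move: s0; rewrite qE rE -mulrDl -rmorphD /=.
rewrite mulf_eq0 invr_eq0 !intr_eq0 (negbTE d0) orbF => ab0.
rewrite !padic_absE// le_max.
have := vzD ab0 a0 b0; rewrite geq_min => /orP[h|h]; apply/orP; [left|right];
  by rewrite ler_weXz2l// lerD2l lerN2 lez_nat.
Qed.

Lemma padic_abs_triangle q r : padic_abs (q + r) <= padic_abs q + padic_abs r.
Proof.
rewrite (le_trans (padic_absD q r))// ge_max lerDl lerDr !padic_abs_ge0//.
Qed.

Lemma padic_abs_eq q r : padic_abs (q - r) < padic_abs r ->
  padic_abs q = padic_abs r.
Proof.
move=> h; apply/eqP; rewrite eq_le; apply/andP; split.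
  by rewrite -{1}(subrK r q) (le_trans (padic_absD _ _))// ge_max lexx (ltW h).
have : padic_abs r <= Num.max (padic_abs q) (padic_abs (q - r)).
  by rewrite -{1}(subKr q r) (le_trans (padic_absD _ _))// padic_absN.
by rewrite le_max => /orP[//|]; rewrite leNgt h.
Qed.

End padic_abs.

Section padic_numbers.
Variable p : prime_number.
Local Notation abs := (padic_abs p).

Definition padic_cauchy : {pred nat -> rat} := [pred x | `[<
  forall e : rat, 0 < e -> exists N, forall m n, (N <= m)%N -> (N <= n)%N ->
    abs (x m - x n) < e >]].

Lemma padic_cauchyP x : reflect (forall e : rat, 0 < e -> exists N,
    forall m n, (N <= m)%N -> (N <= n)%N -> abs (x m - x n) < e)
  (x \in padic_cauchy).
Proof. by apply: (iffP idP) => [/asboolP|/asboolP]. Qed.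

Lemma padic_cauchy_bounded x : x \in padic_cauchy ->
  exists2 M, 0 < M & forall n, abs (x n) <= M.
Proof.
move=> /padic_cauchyP /(_ 1 ltr01) [N xN].
exists (1 + \sum_(i < N.+1) abs (x i)).
  by rewrite ltr_pwDl// sumr_ge0// => i _; exact: padic_abs_ge0.
have le i : (i < N.+1)%N -> abs (x i) <= \sum_(j < N.+1) abs (x j).
  move=> iN; rewrite (bigD1 (Ordinal iN))//= lerDl sumr_ge0// => j _.
  exact: padic_abs_ge0.
move=> n; have [/le h|nN] := ltnP n N.+1; first by rewrite (le_trans h)// lerDr.
rewrite -(subrK (x N) (x n)) (le_trans (padic_abs_triangle _ _ _))// lerD//.
  by rewrite ltW// xN// ltnW.
exact: le.
Qed.

Lemma padic_cauchy_subring : subring_closed padic_cauchy.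
Proof.
split=> [|x y /padic_cauchyP xC /padic_cauchyP yC|x y xC yC]; apply/padic_cauchyP.
- by move=> e e0; exists 0%N => m n _ _; rewrite subrr padic_abs0.
- move=> e e0; have e20 : 0 < e / 2 by rewrite divr_gt0.
  have [N xN] := xC _ e20; have [M yM] := yC _ e20.
  exists (maxn N M) => m n; rewrite !geq_max => /andP[Nm Mm] /andP[Nn Mn].
  rewrite /= !fctE opprD addrACA -opprD.
  rewrite (le_lt_trans (padic_abs_triangle _ _ _))// padic_absN [e]splitr.
  by rewrite ltrD ?xN ?yM.
- have [A A0 xA] := padic_cauchy_bounded xC.
  have [B B0 yB] := padic_cauchy_bounded yC.
  move=> e e0; have e20 : 0 < e / 2 by rewrite divr_gt0.
  have [N xN] := padic_cauchyP _ xC _ (divr_gt0 e20 B0).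
  have [M yM] := padic_cauchyP _ yC _ (divr_gt0 e20 A0).
  exists (maxn N M) => m n; rewrite !geq_max => /andP[Nm Mm] /andP[Nn Mn].
  rewrite /= !fctE.
  have -> : x m * y m - x n * y n = (x m - x n) * y m + x n * (y m - y n).
    by rewrite mulrBl mulrBr addrA subrK.
  rewrite (le_lt_trans (padic_abs_triangle _ _ _))// !padic_absM [e]splitr.
  apply: ltrD.
    apply: le_lt_trans (_ : abs (x m - x n) * B < _).
      by rewrite ler_wpM2l ?padic_abs_ge0.
    by rewrite -ltr_pdivlMr// xN.
  apply: le_lt_trans (_ : A * abs (y m - y n) < _).
    by rewrite ler_wpM2r ?padic_abs_ge0.
  by rewrite mulrC -ltr_pdivlMr// yM.
Qed.

HB.instance Definition _ :=
  GRing.isSubringClosed.Build (nat -> rat) padic_cauchy padic_cauchy_subring.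

Definition padic_cauchy_seq := {x : nat -> rat | x \in padic_cauchy}.
HB.instance Definition _ := [isSub of padic_cauchy_seq for @sval _ _].
HB.instance Definition _ := [Choice of padic_cauchy_seq by <:].
HB.instance Definition _ :=
  [SubChoice_isSubComNzRing of padic_cauchy_seq by <:].

Definition padic_null : {pred padic_cauchy_seq} := [pred x | `[<
  forall e : rat, 0 < e -> exists N, forall n, (N <= n)%N ->
    abs (val x n) < e >]].

Lemma padic_nullP x : reflect (forall e : rat, 0 < e -> exists N,
    forall n, (N <= n)%N -> abs (val x n) < e) (x \in padic_null).
Proof. by apply: (iffP idP) => [/asboolP|/asboolP]. Qed.

Lemma padic_null_ideal : idealr_closed padic_null.
Proof.
split.
- by apply/padic_nullP => e e0; exists 0%N => n _; rewrite raddf0 padic_abs0.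
- apply/negP => /padic_nullP /(_ 1 ltr01)[N /(_ N (leqnn N))].
  by rewrite rmorph1 padic_abs1 ltxx.
move=> a u v /padic_nullP u0 /padic_nullP v0; apply/padic_nullP => e e0.
have e20 : 0 < e / 2 by rewrite divr_gt0.
have [A A0 aA] := padic_cauchy_bounded (valP a).
have [N uN] := u0 _ (divr_gt0 e20 A0); have [M vM] := v0 _ e20.
exists (maxn N M) => n; rewrite geq_max => /andP[Nn Mn].
rewrite rmorphD rmorphM !fctE (le_lt_trans (padic_abs_triangle _ _ _))// padic_absM [e]splitr.
apply: ltrD; last exact: vM.
apply: le_lt_trans (_ : A * abs (val u n) < _).
  by rewrite ler_wpM2r ?padic_abs_ge0 ?aA.
by rewrite mulrC -ltr_pdivlMr// uN.
Qed.

HB.instance Definition _ :=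
  isIdealr.Build padic_cauchy_seq padic_null padic_null_ideal.

(* Q_p: Cauchy sequences of rationals for the p-adic absolute value, modulo null
   sequences. *)
Definition Qp := {ideal_quot padic_null}.
HB.instance Definition _ := GRing.ComNzRing.on Qp.
HB.instance Definition _ := EqQuotient.on Qp.

(* The limit exists in rat: a p-adic absolute value is eventually constant along
   a Cauchy sequence that is not null. *)
Definition padic_norm (x : Qp) : rat :=
  limn (fun n => abs (val (repr x) n) : rat^o).

Lemma padic_norm_cvg (x : padic_cauchy_seq) :
  cvgn (fun n => abs (val x n) : rat^o).
Proof.
have [/padic_nullP x0|] := boolP (x \in padic_null).
  apply/cvg_ex; exists (0 : rat^o); apply/cvgrPdist_lt => e e0.
  have [N xN] := x0 _ e0; exists N => // n /= Nn.
  by rewrite sub0r normrN ger0_norm ?padic_abs_ge0// xN.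
move/asboolPn/existsNP => [e /not_implyP[e0 /forallNP xe]].
have [N xN] := padic_cauchyP _ (valP x) _ e0.
have /existsNP[k /not_implyP[Nk /negP]] := xe N.
rewrite -leNgt => xk; apply/cvg_ex; exists (abs (val x k) : rat^o).
apply/cvgrPdist_lt => d d0; exists N => // n /= Nn.
by rewrite (@padic_abs_eq _ (val x n) (val x k)) ?subrr ?normr0// (lt_le_trans _ xk)// xN.
Qed.

Lemma padic_normE (x : padic_cauchy_seq) :
  padic_norm (\pi_Qp x) = limn (fun n => abs (val x n) : rat^o).
Proof.
rewrite /padic_norm; set y := repr _.
have : y - x \in padic_null by rewrite Quotient.idealrBE reprK.
move=> /padic_nullP yx0.
apply: esym; apply: (@cvg_lim rat^o); first exact: norm_hausdorff.
apply/cvgrPdist_lt => e e0.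
have e20 : 0 < e / 2 by rewrite divr_gt0.
have := @padic_norm_cvg y; move/cvgrPdist_lt => /(_ _ e20)[N _ yN].
have [M yM] := yx0 _ e20.
exists (maxn N M) => // n /=; rewrite geq_max => /andP[Nn Mn].
apply: le_lt_trans (ler_distD (abs (val y n)) _ _) _.
rewrite [e]splitr ltrD//; first exact: yN.
apply: le_lt_trans (yM _ Mn); rewrite rmorphB !fctE.
have yx : abs (val y n) <= abs (val y n - val x n) + abs (val x n).
  by rewrite (le_trans _ (padic_abs_triangle _ _ _))// subrK.
have xy : abs (val x n) <= abs (val y n - val x n) + abs (val y n).
  rewrite -(padic_absN _ (_ - _)) opprB.
  by rewrite (le_trans _ (padic_abs_triangle _ _ _))// subrK.
by rewrite ler_norml lerNl opprB !lerBlDr xy yx.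
Qed.

Let dist (x y : Qp) : rat := padic_norm (x - y).

Let distE (x y : padic_cauchy_seq) : dist (\pi_Qp x) (\pi_Qp y) =
  limn (fun n => abs (val x n - val y n) : rat^o).
Proof.
rewrite /dist (_ : _ - _ = \pi_Qp (x - y)) ?padic_normE//.
by rewrite !piE.
Qed.

Let distxx x : dist x x = 0.
Proof.
rewrite -(reprK x) distE; apply: (@cvg_lim rat^o); first exact: norm_hausdorff.
under eq_fun do rewrite subrr padic_abs0; exact: cvg_cst.
Qed.

Let dist_eq0 x y : dist x y = 0 -> x = y.
Proof.
rewrite -(reprK x) -(reprK y) distE => h; apply/eqP.
rewrite -Quotient.idealrBE; apply/padic_nullP => e e0.
have := @padic_norm_cvg (repr x - repr y); rewrite /= h.
move/cvgrPdist_lt => /(_ _ e0)[N _ xN]; exists N => n Nn.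
by have := xN n Nn; rewrite /= sub0r normrN ger0_norm ?padic_abs_ge0.
Qed.

Let dist_sym x y : dist x y = dist y x.
Proof.
rewrite -(reprK x) -(reprK y) !distE.
by under eq_fun do rewrite -padic_absN opprB.
Qed.

Let dist_triangle y x z : dist x z <= dist x y + dist y z.
Proof.
rewrite -(reprK x) -(reprK y) -(reprK z) !distE.
have cv (a b : Qp) := @padic_norm_cvg (repr a - repr b).
have cD := is_cvgD (cv x y) (cv y z).
apply: le_trans (_ : lim ((fun n => abs (val (repr x - repr y) n) : rat^o) \+
  (fun n => abs (val (repr y - repr z) n) : rat^o) @ \oo) <= _).
  apply: (@ler_lim _ _ _ rat); [exact: (cv x z)|exact: cD|]; near=> n => /=.
  have := padic_abs_triangle p (val (repr x) n - val (repr y) n)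
    (val (repr y) n - val (repr z) n).
  by rewrite addrA subrK.
by rewrite (limD (cv x y) (cv y z)).
Unshelve. all: by end_near. Qed.

HB.instance Definition _ :=
  @isMetric.Build rat Qp dist distxx dist_eq0 dist_sym dist_triangle.

End padic_numbers.

(* A ring with a topology; continuity of the operations is not part of the
   structure. *)
#[short(type="preTopologicalComNzRingType")]
HB.structure Definition PreTopologicalComNzRing :=
  {T of Topological T & GRing.ComNzRing T}.

HB.instance Definition _ (p : prime_number) := GRing.ComNzRing.on (Qp p).

Definition Zp (p : prime_number) : set (Qp p) := [set x | padic_norm x <= 1].

Definition place := option prime_number.
HB.instance Definition _ := Choice.on place.

Definition infty : place := None.
Definition finite_place (p : prime_number) : place := Some p.

Section bruhat_schwartz.
Variable R : realType.
Local Notation C := R[i].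

Definition real_line : preTopologicalComNzRingType :=
  HB.pack (R : Type) (Topological.on R) (GRing.ComNzRing.on R).

Definition Qv (v : place) : preTopologicalComNzRingType :=
  if v is Some p then Qp p else real_line.

(* A_S, the product of the completions at the places of S. *)
Definition semilocal (S : {fset place}) :=
  prod_topology (fun v : S => Qv (val v)).

Definition semilocal_proj (S T : {fset place}) (ST : (S `<=` T)%fset)
  (x : semilocal T) : semilocal S := fun v => x (fincl ST v).

Definition is_subring (S : {fset place}) (K : set (semilocal S)) :=
  [/\ K (fun=> 1),
      forall x y, K x -> K y -> K (fun v => x v - y v) &
      forall x y, K x -> K y -> K (fun v => x v * y v)].

Definition is_max_compact_subring (S : {fset place}) (K : set (semilocal S)) :=
  [/\ compact K, is_subring K & forall L : set (semilocal S),
      compact L -> is_subring L -> K `<=` L -> L = K].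

Definition max_compact_subring (S : {fset place}) : set (semilocal S) :=
  xget set0 (@is_max_compact_subring S).

Definition linear_span (T : Type) (P : set (T -> C)) : set (T -> C) :=
  [set f | exists n (c : 'I_n -> C) (g : 'I_n -> T -> C),
    (forall i, P (g i)) /\ f = \sum_i c i *: g i].

Definition real_schwartz : set (R -> R) := [set u |
  (forall n x, derivable (derive1n n u) x 1) /\
  (forall m n, exists M, forall x, `|x ^+ m * derive1n n u x| <= M)].

(* Differentiability and decay of a complex-valued function of a real variable
   are those of its real and imaginary parts. *)
Definition schwartz : set (R -> C) := [set f |
  real_schwartz (fun x => complex.Re (f x)) /\
  real_schwartz (fun x => complex.Im (f x))].

Definition locally_constant (T : topologicalType) : set (T -> C) :=
  [set f | forall x : T, \forall y \near x, f y = f x].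

Definition compactly_supported (T : topologicalType) : set (T -> C) :=
  [set f | compact (closure [set x | f x != 0])].

Definition local_bruhat_schwartz (v : place) : set (Qv v -> C) :=
  match v return set (Qv v -> C) with
  | Some p => @locally_constant (Qp p) `&` @compactly_supported (Qp p)
  | None => schwartz
  end.

Definition bruhat_schwartz (S : {fset place}) : set (semilocal S -> C) :=
  linear_span [set f | exists2 g : forall v : S, Qv (val v) -> C,
    forall v, local_bruhat_schwartz (g v) & f = fun x => \prod_v g v (x v)].

(* f |-> 1_R (x) f, with R the maximal compact subring of the product of the
   completions at the places of T not in S. *)
Definition gamma (S T : {fset place}) (ST : (S `<=` T)%fset)
    (f : semilocal S -> C) : semilocal T -> C := fun x =>
  \1_(@max_compact_subring (T `\` S)%fset) (semilocal_proj (fsubsetDl T S) x)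
  * f (semilocal_proj ST x).

(* The restricted product; the archimedean coordinate is unconstrained. *)
Definition adele := {x : forall v, Qv v |
  finite_set [set p | ~ Zp (x (finite_place p))]}.

Definition adele_proj (S : {fset place}) (x : adele) : semilocal S :=
  fun v => sval x (val v).

(* The product over all places has only finitely many factors different from 1
   at a given adele. *)
Definition adelic_bruhat_schwartz : set (adele -> C) :=
  linear_span [set f | exists g : forall v, Qv v -> C,
    [/\ forall v, local_bruhat_schwartz (g v),
        finite_set [set p | g (finite_place p) <> \1_(@Zp p)] &
        f = fun x => \big[*%R/1]_(v \in setT) g v (sval x v)]].

(* f (x) (tensor product of the 1_{Z_p} for p not in S). *)
Definition adelic_extension (S : {fset place}) (f : semilocal S -> C) :
    adele -> C := fun x =>
  \1_[set y : adele | forall p, finite_place p \notin S ->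
                        Zp (sval y (finite_place p))] x
  * f (adele_proj x).

End bruhat_schwartz.

(* An algebra is carried by the subset amem of an ambient type; the operations
   are only meaningful on that subset. Algebras are commutative but need not
   have a unit: spaces of Schwartz functions have none. *)
Record raw_algebra (K : Type) := RawAlgebra {
  carrier : Type;
  amem : set carrier;
  azero : carrier;
  aopp : carrier -> carrier;
  aadd : carrier -> carrier -> carrier;
  ascale : K -> carrier -> carrier;
  amul : carrier -> carrier -> carrier }.
Arguments amem {K A} : rename.
Arguments azero {K A} : rename.
Arguments aopp {K A} : rename.
Arguments aadd {K A} : rename.
Arguments ascale {K A} : rename.
Arguments amul {K A} : rename.

Section algebras.
Variable K : comNzRingType.
Implicit Types A B : raw_algebra K.

Record is_algebra A : Prop := IsAlgebra {
  amem0 : amem (@azero _ A);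
  amemN : forall x : carrier A, amem x -> amem (aopp x);
  amemD : forall x y : carrier A, amem x -> amem y -> amem (aadd x y);
  amemZ : forall a (x : carrier A), amem x -> amem (ascale a x);
  amemM : forall x y : carrier A, amem x -> amem y -> amem (amul x y);
  aaddA : forall x y z : carrier A, amem x -> amem y -> amem z ->
    aadd x (aadd y z) = aadd (aadd x y) z;
  aaddC : forall x y : carrier A, amem x -> amem y -> aadd x y = aadd y x;
  aadd0 : forall x : carrier A, amem x -> aadd azero x = x;
  aaddN : forall x : carrier A, amem x -> aadd (aopp x) x = azero;
  ascaleA : forall a b (x : carrier A), amem x ->
    ascale a (ascale b x) = ascale (a * b) x;
  ascale1 : forall x : carrier A, amem x -> ascale 1 x = x;
  ascaleDr : forall a (x y : carrier A), amem x -> amem y ->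
    ascale a (aadd x y) = aadd (ascale a x) (ascale a y);
  ascaleDl : forall a b (x : carrier A), amem x ->
    ascale (a + b) x = aadd (ascale a x) (ascale b x);
  amulA : forall x y z : carrier A, amem x -> amem y -> amem z ->
    amul x (amul y z) = amul (amul x y) z;
  amulC : forall x y : carrier A, amem x -> amem y -> amul x y = amul y x;
  amulDl : forall x y z : carrier A, amem x -> amem y -> amem z ->
    amul (aadd x y) z = aadd (amul x z) (amul y z);
  ascaleAl : forall a (x y : carrier A), amem x -> amem y ->
    amul (ascale a x) y = ascale a (amul x y) }.

Record algebra_morphism A B (f : carrier A -> carrier B) : Prop :=
  AlgebraMorphism {
  amorph_mem : forall x, amem x -> amem (f x);
  amorphD : forall x y, amem x -> amem y -> f (aadd x y) = aadd (f x) (f y);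
  amorphZ : forall a x, amem x -> f (ascale a x) = ascale a (f x);
  amorphM : forall x y, amem x -> amem y -> f (amul x y) = amul (f x) (f y) }.

Definition algebra_isomorphism A B (f : carrier A -> carrier B) :=
  [/\ is_algebra A, is_algebra B, algebra_morphism f & set_bij amem amem f].

End algebras.

Definition function_algebra (R : realType) (T : Type) (P : set (T -> R[i])) :
  raw_algebra R[i] := RawAlgebra P 0 -%R +%R *:%R *%R.

Definition opens (X : topologicalType) := {U : set X | open U}.
Definition opens_set (X : topologicalType) (U : opens X) : set X := sval U.
Coercion opens_set : opens >-> set.

Definition opensT (X : topologicalType) : opens X := exist _ setT openT.
Definition opensI (X : topologicalType) (U V : opens X) : opens X :=
  exist _ (U `&` V) (openI (svalP U) (svalP V)).

Lemma opensIl (X : topologicalType) (U V : opens X) : opensI U V `<=` U.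
Proof. exact: subIsetl. Qed.

Lemma opensIr (X : topologicalType) (U V : opens X) : opensI U V `<=` V.
Proof. exact: subIsetr. Qed.

Arguments opensIl {X} U V.
Arguments opensIr {X} U V.

Record raw_presheaf (K : Type) (X : topologicalType) := RawPresheaf {
  sections : opens X -> raw_algebra K;
  restr : forall U V : opens X, V `<=` U ->
    carrier (sections U) -> carrier (sections V) }.
Arguments restr {K X} F {U V} VU : rename.

Section sheaves.
Variables (K : comNzRingType) (X : topologicalType) (F : raw_presheaf K X).
Local Notation sections := (sections F).
Local Notation restr := (restr F).

Record is_presheaf_of_algebras : Prop := IsPresheafOfAlgebras {
  sections_algebra : forall U, is_algebra (sections U);
  restr_morphism : forall (U V : opens X) (VU : V `<=` U),
    algebra_morphism (restr VU);
  restr_id : forall (U : opens X) (UU : U `<=` U) (s : carrier (sections U)),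
    amem s -> restr UU s = s;
  restr_comp : forall (U V W : opens X) (VU : V `<=` U) (WV : W `<=` V)
    (WU : W `<=` U) (s : carrier (sections U)),
    amem s -> restr WV (restr VU s) = restr WU s }.

Record is_sheaf_of_algebras : Prop := IsSheafOfAlgebras {
  sheaf_presheaf : is_presheaf_of_algebras;
  sheaf_separated : forall (U : opens X) (I : Type) (V : I -> opens X)
      (VU : forall i, V i `<=` U) (s t : carrier (sections U)),
    U `<=` \bigcup_i V i -> amem s -> amem t ->
    (forall i, restr (VU i) s = restr (VU i) t) -> s = t;
  sheaf_glue : forall (U : opens X) (I : Type) (V : I -> opens X)
      (VU : forall i, V i `<=` U) (s : forall i, carrier (sections (V i))),
    U `<=` \bigcup_i V i -> (forall i, amem (s i)) ->
    (forall i j,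
      restr (opensIl (V i) (V j)) (s i) =
      restr (opensIr (V i) (V j)) (s j)) ->
    exists2 t, amem t & forall i, restr (VU i) t = s i }.

Section stalk.
Variable x : X.

Record local_section := LocalSection {
  domain : opens X;
  section_on : carrier (sections domain) }.

Definition local_section_at : set local_section :=
  [set g | opens_set (domain g) x /\ amem (section_on g)].

Definition same_germ (g h : local_section) :=
  exists (W : opens X) (Wg : W `<=` domain g) (Wh : W `<=` domain h),
    opens_set W x /\ restr Wg (section_on g) = restr Wh (section_on h).

Definition germ (U : opens X) (s : carrier (sections U)) : set local_section :=
  [set h | local_section_at h /\ same_germ (LocalSection s) h].

(* Operations on classes: restrict representatives to a common open
   neighbourhood W of x, operate there, and take the class of the result. *)
Definition stalk : raw_algebra K := RawAlgebra
  [set c | exists (U : opens X) (s : carrier (sections U)),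
    [/\ opens_set U x, amem s & c = germ s]]
  (germ (@azero _ (sections (opensT X))))
  (fun c => [set k | exists2 g, c g & germ (aopp (section_on g)) k])
  (fun c d => [set k | exists g h (W : opens X) (Wg : W `<=` domain g)
    (Wh : W `<=` domain h), [/\ c g, d h, opens_set W x &
      germ (aadd (restr Wg (section_on g)) (restr Wh (section_on h))) k]])
  (fun a c => [set k | exists2 g, c g & germ (ascale a (section_on g)) k])
  (fun c d => [set k | exists g h (W : opens X) (Wg : W `<=` domain g)
    (Wh : W `<=` domain h), [/\ c g, d h, opens_set W x &
      germ (amul (restr Wg (section_on g)) (restr Wh (section_on h))) k]]).

End stalk.
End sheaves.

Section spectrum.
Variable A : comNzRingType.

Definition Spec := {I : A -> bool | idealr_closed I /\ prime_idealr_closed I}.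
Definition prime_of (P : Spec) : {pred A} := sval P.
HB.instance Definition _ := gen_eqMixin Spec.
HB.instance Definition _ := gen_choiceMixin Spec.

Lemma eq_Spec (P Q : Spec) : sval P = sval Q -> P = Q.
Proof.
by case: P Q => [P hP] [Q hQ] /= PQ; subst Q; congr exist; exact: Prop_irrelevance.
Qed.

(* Complements of the closed sets V(E) = {P | E included in P}. *)
Definition zariski_open : set_system Spec :=
  [set U | exists E : set A, U = [set P | exists2 a, E a & a \notin prime_of P]].

Let zariskiT : zariski_open setT.
Proof.
exists [set 1]; apply/seteqP; split=> // P _; exists 1 => //.
by case: (svalP P) => -[].
Qed.

Let zariskiI : setI_closed zariski_open.
Proof.
move=> _ _ [D ->] [E ->].
exists [set x | exists a b, [/\ D a, E b & x = a * b]].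
apply/seteqP; split=> P /=.
  move=> [[a Da aP] [b Eb bP]]; exists (a * b); first by exists a, b.
  apply/negP => /(svalP P).2; by rewrite (negbTE aP) (negbTE bP).
move=> [_ [a [b [Da Eb ->]]] abP]; have [P0 _ PD] := (svalP P).1.
split; [exists a|exists b] => //; apply: contra abP => h.
  by rewrite mulrC -[_ * _]addr0 PD.
by rewrite -[_ * _]addr0 PD.
Qed.

Let zariski_bigU (I : Type) (f : I -> set Spec) :
  (forall i, zariski_open (f i)) -> zariski_open (\bigcup_i f i).
Proof.
move=> /choice[E fE]; exists (\bigcup_i E i); apply/seteqP; split=> P.
  by move=> [i _]; rewrite fE => -[a Ea aP]; exists a => //; exists i.
by move=> [a [i _ Ea] aP]; exists i => //; rewrite fE; exists a.
Qed.

HB.instance Definition _ :=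
  isOpenTopological.Build Spec zariskiT zariskiI zariski_bigU.

End spectrum.

Definition SpecZ := Spec int.
HB.instance Definition _ := Topological.on SpecZ.

Fact zero_ideal_prime :
  idealr_closed (pred1 (0 : int)) /\ prime_idealr_closed (pred1 (0 : int)).
Proof.
split; last by move=> u v; rewrite !inE mulf_eq0.
split; [by rewrite inE|by rewrite inE oner_eq0|].
by move=> a u v; rewrite !inE => /eqP-> /eqP->; rewrite mulr0 addr0.
Qed.

Definition generic_point : SpecZ := exist _ _ zero_ideal_prime.

Fact multiples_prime (p : prime_number) :
  idealr_closed (dvdz (val p)%:Z : {pred int}) /\
  prime_idealr_closed (dvdz (val p)%:Z : {pred int}).
Proof.
split; first split.
- exact: dvdz0.
- by rewrite dvdzE /= dvdn1 gtn_eqF// prime_gt1// (valP p).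
- by move=> a u v pu pv; rewrite rpredD// dvdz_mull.
by move=> u v; rewrite !dvdzE abszM Euclid_dvdM// (valP p).
Qed.

Definition closed_point (p : prime_number) : SpecZ :=
  exist _ _ (multiples_prime p).

(* The set S such that U = S^c, for a nonempty open U; see complement_ofK and
   places_ofK below. *)
Definition places_set (U : set SpecZ) : set place :=
  infty |` finite_place @` [set p | ~ U (closed_point p)].

Lemma places_set_finite (U : opens SpecZ) :
  U !=set0 -> finite_set (places_set U).
Proof.
case: U => U oU; rewrite /places_set /= => -[P UP].
rewrite finite_setU; split; first exact: finite_set1.
apply: finite_image; have [E UE] : zariski_open U := oU.
have [e Ee eP] : exists2 a, E a & a \notin prime_of P by move: UP; rewrite /= UE.
have e0 : (0 < `|e|)%N.
  rewrite absz_gt0; apply: contraNneq eP => ->.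
  by have [] := (svalP P).1.
apply: (@sub_finite_set _ _ (val @^-1` `I_(`|e|.+1))).
  move=> p /= Up; rewrite ltnS dvdn_leq//; apply: contrapT => pe.
  apply: Up; rewrite UE; exists e => //=; apply/negP => h; exact: pe.
apply: finite_preimage; last exact: finite_II.
by move=> p q _ _; exact: val_inj.
Qed.

Definition places_of (U : opens SpecZ) : {fset place} := fset_set (places_set U).

Lemma places_of_infty (U : opens SpecZ) :
  U !=set0 -> ([fset infty] `<=` places_of U)%fset.
Proof.
by move=> U0; rewrite fsub1set in_fset_set ?inE; [left|exact: places_set_finite].
Qed.

Lemma places_of_sub (U V : opens SpecZ) :
  V `<=` U -> V !=set0 -> (places_of U `<=` places_of V)%fset.
Proof.
move=> VU V0; have U0 : U !=set0 by case: V0 => P /VU; exists P.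
rewrite -fset_set_sub; try exact: places_set_finite.
by apply: setUS; apply: image_subset => p; apply: contra_not; exact: VU.
Qed.

Lemma closed_pointP (p : prime_number) (P : SpecZ) :
  (P = closed_point p) <-> (val p)%:Z \in prime_of P.
Proof.
split=> [->|pP]; first by rewrite [_ \in _]dvdzz.
have [P0 P1 PD] := (svalP P).1; apply: eq_Spec; apply/funext => a.
rewrite -[RHS]/((val p)%:Z %| a)%Z; apply/idP/idP => [aP|/dvdzP[b ->]].
  apply: contraT => pa; have : coprimez (val p)%:Z a.
    by rewrite coprimezE prime_coprime// (valP p).
  move=> /coprimezP [[u v] /= uv]; case/negP: P1; rewrite -uv.
  by rewrite PD// -[v * a]addr0 PD.
by rewrite -[b * _]addr0; exact: PD.
Qed.

Lemma closed_point_inj : injective closed_point.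
Proof.
move=> p q /esym /closed_pointP; rewrite [_ \in _]dvdzE /=.
by rewrite dvdn_prime2 ?(valP p) ?(valP q)// => /eqP /val_inj ->.
Qed.

Lemma open_complement (S : {fset place}) :
  open [set P : SpecZ | forall p, finite_place p \in S -> P <> closed_point p].
Proof.
have -> : [set P : SpecZ | forall p, finite_place p \in S ->
    P <> closed_point p] =
    ~` \bigcup_(v in [set` S]) [set P | exists2 p, v = finite_place p &
      P = closed_point p].
  apply/seteqP; split=> P /=; first by move=> h [v vS [p vE]]; apply: h; rewrite -vE.
  by move=> h p pS Pp; apply: h; exists (finite_place p) => //; exists p.
rewrite openC; apply: closed_bigcup; first exact: finite_fset.
move=> [p|] _; last first.
  rewrite (_ : [set _ | _] = set0); first exact: closed0.
  by apply/seteqP; split=> // P [].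
rewrite -openC; exists [set (val p)%:Z]; apply/seteqP; split=> P /=.
  move=> h; exists (val p)%:Z => //; apply/negP => /closed_pointP Pp.
  by apply: h; exists p.
move=> [_ -> /negP pP] [q [<-] Pq]; exact/pP/closed_pointP.
Qed.

Definition complement_of (S : {fset place}) : opens SpecZ :=
  exist _ _ (open_complement S).

Lemma complement_ofK (S : {fset place}) :
  infty \in S -> places_of (complement_of S) = S.
Proof.
move=> S0; apply/fsetP => v; rewrite in_fset_set; last first.
  apply: places_set_finite; exists generic_point => p _ /closed_pointP.
  by rewrite inE eqz_nat gtn_eqF// prime_gt0// (valP p).
apply/idP/idP; rewrite inE /places_set /=.
  move=> [->//|[p /= + <-]] => /existsNP[q /not_implyP[Sq]].
  by move=> /contrapT /closed_point_inj ->.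
case: v => [p|_]; last by left.
by move=> Sp; right; exists p => //=; move=> /(_ p Sp).
Qed.

Lemma generic_complement (S : {fset place}) :
  opens_set (complement_of S) generic_point.
Proof.
move=> p _ /closed_pointP.
by rewrite inE eqz_nat gtn_eqF// prime_gt0// (valP p).
Qed.

Lemma prime_int_ideal (P : SpecZ) :
  P = generic_point \/ exists p, P = closed_point p.
Proof.
have [P0 P1 PD] := (svalP P).1; have Pp := (svalP P).2.
have [[e eP e0]|h] := pselect (exists2 e, e \in prime_of P & e != 0); last first.
  left; apply: eq_Spec; apply/funext => a /=; apply/idP/eqP => [aP|->//].
  by apply: contrapT => /eqP a0; apply: h; exists a.
right; have {e eP e0}: exists2 n, n%:Z \in prime_of P & (0 < n)%N.
  exists `|e|%N; last by rewrite absz_gt0.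
  by rewrite abszEsign -[_ * _]addr0; exact: PD.
move=> [n]; elim/ltn_ind: n => n IH nP n0.
have [n1|n1] := leqP n 1.
  by move: nP P1; rewrite (_ : n = 1%N) => [->//|]; apply/eqP; rewrite eqn_leq n1.
have dn := divnK (pdiv_dvd n); rewrite -dn PoszM in nP.
have /orP[qP|pP] := Pp _ _ nP; last first.
  by exists (Sub (pdiv n) (pdiv_prime n1)); exact/closed_pointP.
apply: (IH (n %/ pdiv n)%N) => //.
  by rewrite ltn_Pdiv// prime_gt1// pdiv_prime.
by rewrite divn_gt0 ?pdiv_gt0// pdiv_leq.
Qed.

Lemma places_ofK (U : opens SpecZ) : U !=set0 ->
  opens_set (complement_of (places_of U)) = U.
Proof.
move=> U0; apply/seteqP; split=> P /=; last first.
  move=> UP p; rewrite in_fset_set ?inE; last exact: places_set_finite.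
  by move=> -[//|[q /= Uq [<-]]] Pq; apply: Uq; rewrite -Pq.
move=> h; have [PE|[p PE]] := prime_int_ideal P.
  have [E UE] : zariski_open U := svalP U.
  case: U0 => Q; rewrite UE => -[e Ee eQ]; exists e => //.
  rewrite PE; apply: contra eQ => /eqP ->; by have [] := (svalP Q).1.
apply: contrapT => nUP; apply: (h p) => //.
rewrite in_fset_set ?inE; last exact: places_set_finite.
by right; exists p => //= Up; apply: nUP; rewrite PE.
Qed.

Lemma SpecZ_neq0 : opensT SpecZ !=set0.
Proof. by exists generic_point. Qed.

Section structure_sheaf.
Variable R : realType.

(* S(A_S) on the nonempty open S^c, and the zero algebra on the empty open. *)
Definition schwartz_sections (U : opens SpecZ) :
    set (semilocal R (places_of U) -> R[i]) :=
  if pselect (U !=set0) then @bruhat_schwartz R (places_of U) else [set 0].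

Definition schwartz_restr (U V : opens SpecZ) (VU : V `<=` U) :
    (semilocal R (places_of U) -> R[i]) -> semilocal R (places_of V) -> R[i] :=
  if pselect (V !=set0) is left V0 then @gamma R _ _ (places_of_sub VU V0)
  else fun=> 0.

Definition schwartz_sheaf : raw_presheaf R[i] SpecZ :=
  RawPresheaf (sections := fun U => function_algebra (@schwartz_sections U))
    schwartz_restr.

End structure_sheaf.

(* Main.v *)
Require Import Defs.
From HB Require Import structures.
From mathcomp Require Import all_boot all_order all_algebra finmap.
From mathcomp Require Import all_classical all_reals all_analysis complex.
Set Implicit Arguments.
Unset Strict Implicit.
Unset Printing Implicit Defensive.
Import Order.TTheory GRing.Theory Num.Theory.
Import numFieldNormedType.Exports.
Local Open Scope classical_set_scope.
Local Open Scope ring_scope.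
Local Open Scope quotient_scope.

(* The ring of p-adic integers, not the integers modulo n. *)
Local Notation Zp := (@Defs.Zp).

(** Functions on A_S are compared, for varying S, by pulling them back to the
    product of all the completions, whose elements (called points below)
    restrict to every A_S by [trunc]. A compact subring of a finite product of
    p-adic fields consists of integral elements, because the powers of a
    non-integral one are unbounded; so the maximal compact subring is the
    product of the Z_p, and on points gamma multiplies a function by the
    indicator of the points that are integral at the new places
    ([gamma_trunc]). That gamma is multiplicative, functorial and injective is
    then visible. That it preserves Bruhat-Schwartz functions comes down to
    Z_p being open and compact; that these functions are stable under products
    comes down, at the real place, to the Leibniz rule.

    Gluing. All nonempty open subsets of Spec Z contain the generic point, so
    two nonempty members V_k and V_i of a cover of U always meet. Fix k. If p
    lies in U but not in V_k, then some V_i contains p, and the agreement of s_k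
    with s_i on the intersection says that s_k is the tensor product of 1_{Z_p}
    with a function of the other coordinates ([gamma_eq_unramified_at]). As only
    finitely many p are concerned, s_k is the image under gamma of the function
    t obtained by setting these coordinates to 0 ([gamma_descent]), and t is a
    Bruhat-Schwartz function because freezing coordinates of a pure tensor
    leaves a multiple of a pure tensor ([bruhat_schwartz_freeze]). Injectivity
    of gamma shows that t glues all the sections, and that it is unique.

    Stalk. Extending a section to the adeles by a tensor product with all the
    remaining 1_{Z_p} is compatible with restriction and injective, so that
    having the same germ at the generic point is having the same adelic
    extension ([same_germE]). Every adelic Bruhat-Schwartz function is such an
    extension, as its finitely many pure tensors have almost all their factors
    equal to 1_{Z_p} ([adelic_bruhat_schwartzE]).

    Global sections. The set of places attached to the open set Spec Z consists
    of the real place alone, so that gamma from the real place to it is an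
    identity map; and pure tensors over the real place are Schwartz
    functions. *)

(** * The p-adic norm *)

Section padic_norm_theory.
Variable p : prime_number.
Implicit Types (x y z : Qp p) (n k : nat).

Lemma padic_norm_cvg_to (u : padic_cauchy_seq p) :
  (fun n => padic_abs p (val u n) : rat^o) @ \oo -->
  (padic_norm (\pi_(Qp p) u) : rat^o).
Proof. by rewrite padic_normE; exact: padic_norm_cvg. Qed.

Lemma padic_norm_le (u : padic_cauchy_seq p) (r : rat) N :
  (forall n, (N <= n)%N -> padic_abs p (val u n) <= r) ->
  padic_norm (\pi_(Qp p) u) <= r.
Proof.
move=> ur; rewrite padic_normE; apply: limr_le; first exact: padic_norm_cvg.
by exists N.
Qed.

Lemma padic_norm_near_lt (u : padic_cauchy_seq p) (r : rat) :
  padic_norm (\pi_(Qp p) u) < r ->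
  exists N, forall n, (N <= n)%N -> padic_abs p (val u n) < r.
Proof.
move=> ur; have := @padic_norm_cvg_to u.
by move=> /cvgr_lt /(_ _ ur) [N _ uN]; exists N => n /uN.
Qed.

Lemma padic_norm_ge0 x : 0 <= padic_norm x.
Proof.
rewrite -(reprK x) padic_normE; apply: limr_ge; first exact: padic_norm_cvg.
by apply: nearW => n; exact: padic_abs_ge0.
Qed.

Lemma padic_normM x y : padic_norm (x * y) = padic_norm x * padic_norm y.
Proof.
rewrite -[in LHS](reprK x) -[in LHS](reprK y) -rmorphM.
apply: (@cvg_unique _ (@norm_hausdorff _ rat^o) _ _ _ _ (@padic_norm_cvg_to _)).
rewrite (_ : (fun n => _) = (fun n => padic_abs p (val (repr x) n) : rat^o) \*
    (fun n => padic_abs p (val (repr y) n) : rat^o)).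
  have cvg z : (fun n => padic_abs p (val (repr z) n) : rat^o) @ \oo -->
      (padic_norm z : rat^o).
    by have := @padic_norm_cvg_to (repr z); rewrite reprK.
  by apply: cvgM; exact: cvg.
by apply/funext => n; rewrite rmorphM /= padic_absM.
Qed.

Lemma padic_normD x y e :
  padic_norm x <= e -> padic_norm y <= e -> padic_norm (x + y) <= e.
Proof.
move=> xe ye; apply/ler_addgt0Pr => d d0.
have lt z : padic_norm z <= e -> padic_norm (\pi_(Qp p) (repr z)) < e + d.
  by move=> ze; rewrite reprK (le_lt_trans ze)// ltrDl.
have [N xN] := padic_norm_near_lt (lt _ xe).
have [M yM] := padic_norm_near_lt (lt _ ye).
rewrite -(reprK x) -(reprK y) -rmorphD; apply: (@padic_norm_le _ _ (maxn N M)).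
move=> n; rewrite geq_max => /andP[Nn Mn].
rewrite rmorphD (le_trans (padic_absD _ _ _))// ge_max.
by rewrite !ltW ?xN ?yM.
Qed.

Lemma padic_norm_nat n :
  padic_norm (n%:R : Qp p) = padic_abs p n%:R.
Proof.
rewrite -(rmorph_nat \pi_(Qp p)) padic_normE rmorph_nat.
rewrite (_ : (fun _ => _) = fun=> padic_abs p n%:R).
  exact: (@lim_cst _ (@norm_hausdorff _ rat^o)).
by apply/funext => k; rewrite natmulfctE.
Qed.

Lemma padic_norm_nat_le1 n : padic_norm (n%:R : Qp p) <= 1.
Proof.
elim: n => [|n IH]; first by rewrite padic_norm_nat padic_abs0.
by rewrite -addn1 natrD padic_normD// padic_norm_nat padic_abs1.
Qed.

Lemma padic_norm0 : padic_norm (0 : Qp p) = 0.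
Proof. by rewrite (padic_norm_nat 0) padic_abs0. Qed.

Lemma padic_norm1 : padic_norm (1 : Qp p) = 1.
Proof. by rewrite (padic_norm_nat 1) padic_abs1. Qed.

Lemma padic_normN x : padic_norm (- x) = padic_norm x.
Proof.
rewrite -(reprK x) -rmorphN !padic_normE.
by under eq_fun do rewrite rmorphN padic_absN.
Qed.

Lemma Zp0 : Zp p 0.
Proof. by rewrite /Zp /= padic_norm0. Qed.

Lemma Zp1 : Zp p 1.
Proof. by rewrite /Zp /= padic_norm1. Qed.

Lemma ZpB x y : Zp p x -> Zp p y -> Zp p (x - y).
Proof. by move=> x1 y1; apply: padic_normD => //; rewrite padic_normN. Qed.

Lemma ZpM x y : Zp p x -> Zp p y -> Zp p (x * y).
Proof.
by rewrite /Zp /= => x1 y1; rewrite padic_normM mulr_ile1 ?padic_norm_ge0.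
Qed.

Lemma padic_ballE x e : ball x e = [set y | padic_norm (x - y) < e].
Proof. exact: ballEmdist. Qed.

(** By the ultrametric inequality, both Zp and its complement are unions of
    balls of radius 1. *)
Lemma near_Zp x : \forall y \near x, Zp p y <-> Zp p x.
Proof.
have := nbhsx_ballx x _ (@ltr01 rat); apply: filterS => y.
rewrite padic_ballE /= => /ltW xy; split=> h.
  by rewrite -(subrK y x); exact: padic_normD.
by rewrite -(subrK x y); apply: padic_normD => //; rewrite -opprB padic_normN.
Qed.

Lemma Zp_closed : closed (Zp p).
Proof.
move=> x /(_ _ (near_Zp x)) [y [yZ]]; exact: (fun h => iffLR h yZ).
Qed.

End padic_norm_theory.

(** * Compactness of the p-adic integers *)

Section Zp_compact.
Variable p : prime_number.
Implicit Types (x y z : Qp p) (n k : nat).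

Let q : rat := (val p)%:R.
Let ppr : prime (val p) := valP p.
Let q0 : 0 < q. Proof. by rewrite ltr0n prime_gt0. Qed.

Lemma padic_abs_int_le (a : int) k : ((val p ^ k)%N%:Z %| a)%Z ->
  padic_abs p a%:~R <= (q ^+ k)^-1.
Proof.
have [->|a0] := eqVneq a 0.
  by rewrite padic_abs0 invr_ge0 exprn_ge0// ltW.
move=> dv; rewrite -(divr1 a%:~R) -[1]/(1%:~R) padic_absE//=.
rewrite logn1 sub0r -invr_expz lef_pV2 ?posrE ?exprn_gt0 ?exprz_gt0//.
by rewrite -exprnP ler_weXn2l ?ler1n ?prime_gt0// -pfactor_dvdn ?absz_gt0.
Qed.

Lemma padic_norm_natB m n :
  padic_norm (m%:R - n%:R : Qp p) = padic_abs p (m%:R - n%:R).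
Proof.
wlog nm : m n / (n <= m)%N.
  move=> wl; case/orP: (leq_total n m) => nm; first exact: wl.
  by rewrite -opprB padic_normN -[in RHS]opprB padic_absN wl.
by rewrite -!natrB// padic_norm_nat.
Qed.

Lemma padic_abs_denq (r : rat) :
  padic_abs p r <= 1 -> ~~ (val p %| `|denq r|)%N.
Proof.
have [->|r0] := eqVneq r 0; first by rewrite dvdn1 gtn_eqF// prime_gt1.
move=> r1; apply/negP => pr; move: r1; rewrite /padic_abs (negbTE r0).
have -> : padic_val p r = - (logn (val p) `|denq r|)%:Z.
  rewrite /padic_val; suff -> : logn (val p) `|numq r| = 0%N by rewrite sub0r.
  apply/eqP; rewrite -leqn0 leqNgt -[(0 < _)%N]/(1 <= _)%N.
  rewrite -pfactor_dvdn ?absz_gt0 ?numq_eq0// expn1; apply/negP => pn.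
  have := coprime_num_den r; rewrite /coprime => /eqP cp.
  have : (val p %| gcdn `|numq r| `|denq r|)%N by rewrite dvdn_gcd pn.
  by rewrite cp dvdn1 gtn_eqF// prime_gt1.
apply/negP; rewrite opprK -exprnP -ltNge exprn_egt1 ?ltr1n ?prime_gt1//.
rewrite -lt0n -[(0 < _)%N]/(1 <= _)%N.
by rewrite -pfactor_dvdn ?absz_gt0 ?denq_neq0// expn1.
Qed.

(** The denominator b of r is invertible modulo the k-th power of p, so c can be
    taken congruent to the numerator times a Bezout inverse of b. *)
Lemma padic_abs_le1_approx (r : rat) k : padic_abs p r <= 1 ->
  exists2 c, (c < val p ^ k)%N & padic_abs p (r - c%:R) <= (q ^+ k)^-1.
Proof.
move=> /padic_abs_denq pr; set b := denq r in pr *; set a := numq r.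
have P0 : (0 < val p ^ k)%N by rewrite expn_gt0 prime_gt0.
have /coprimezP[[u v] /= uv] : coprimez (val p ^ k)%N%:Z b.
  by rewrite coprimezE /= coprimeXl// prime_coprime.
pose c := (a * v %% (val p ^ k)%N%:Z)%Z.
have c0 : 0 <= c by rewrite modz_ge0// gt_eqF.
have cE : `|c|%N%:Z = c by rewrite gez0_abs.
exists `|c|%N; first by rewrite -ltz_nat cE ltz_pmod.
have absb : padic_abs p b%:~R = 1.
  rewrite -(divr1 b%:~R) -[1]/(1%:~R) padic_absE ?denq_neq0//= logn1 sub0r.
  suff -> : logn (val p) `|b| = 0%N by [].
  apply/eqP; rewrite -leqn0 leqNgt -[(0 < _)%N]/(1 <= _)%N.
  by rewrite -pfactor_dvdn ?absz_gt0 ?denq_neq0// expn1.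
rewrite -[leLHS]mulr1 -[X in _ * X]absb -padic_absM mulrBl {1}/b -numqE.
rewrite (pmulrn 1 `|c|%N) cE -rmorphM -rmorphB; apply: padic_abs_int_le.
have -> : a - c * b = a * u * (val p ^ k)%N%:Z + (a * v - c) * b.
  rewrite -[LHS]/(a - c * b).
  by rewrite [(a * v - c) * b]mulrBl addrA -!mulrA -mulrDr uv mulr1.
apply: rpredD; [exact: dvdz_mull|apply: dvdz_mulr].
by rewrite /c {1}(divz_eq (a * v) (val p ^ k)%N%:Z) addrK dvdz_mull.
Qed.

Let valB_nat (u : padic_cauchy_seq p) c n :
  val (u - c%:R) n = val u n - c%:R.
Proof. by rewrite rmorphB rmorph_nat natmulfctE. Qed.

(** A rational term of a Cauchy sequence of class x approximates x, and it has
    absolute value at most 1: otherwise this absolute value would be shared by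
    all later terms, hence by x. *)
Lemma Zp_approx x k : Zp p x ->
  exists2 c, (c < val p ^ k)%N & padic_norm (x - c%:R) <= (q ^+ k)^-1.
Proof.
rewrite -(reprK x); set u := repr x => x1.
have e0 : 0 < (q ^+ k)^-1 by rewrite invr_gt0 exprn_gt0.
have [N uN] := padic_cauchyP _ _ (valP u) _ e0.
have e1 : (q ^+ k)^-1 <= 1.
  by rewrite invf_le1 ?exprn_gt0// exprn_ege1// ler1n prime_gt0.
have [|c cp uc] := @padic_abs_le1_approx (val u N) k.
  rewrite leNgt; apply/negP => uN1; move: x1; rewrite /Defs.Zp /=; apply/negP.
  rewrite -ltNge (lt_le_trans uN1)// padic_normE; apply: limr_ge.
    exact: padic_norm_cvg.
  exists N => // n /= Nn; rewrite (@padic_abs_eq p (val u n) (val u N))//.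
  by rewrite (lt_trans (uN _ _ _ _))// (le_lt_trans e1).
exists c => //; rewrite -(rmorph_nat \pi_(Qp p)) -rmorphB.
apply: (@padic_norm_le _ _ _ N) => n Nn.
rewrite valB_nat -(subrK (val u N) (val u n)) -addrA.
by rewrite (le_trans (padic_absD _ _ _))// ge_max uc andbT ltW// uN.
Qed.

(** At each scale, Zp is a finite union of balls centred at integers, one of
    which belongs to a given ultrafilter. The centres of the selected balls form
    a Cauchy sequence of integers, whose class is the limit. *)
Lemma compact_Zp : compact (Zp p).
Proof.
rewrite compact_ultra => F UF FZ.
have PF : ProperFilter F by exact: ultra_proper.
pose B c k : set (Qp p) := [set x | padic_norm (x - c%:R) <= (q ^+ k)^-1].
have pigeon k N :
    F [set x | exists2 c, (c < N)%N & B c k x] -> exists c, F (B c k).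
  elim: N => [|N IH] FN.
    by have /filter_ex[x []] := FN.
  have [FB|FB] := in_ultra_setVsetC (B N k) UF; first by exists N.
  apply: IH; apply: filterS2 FN FB => x [c cN xc] xN; exists c => //.
  by move: cN; rewrite ltnS leq_eqVlt => /predU1P[cE|//]; rewrite cE in xc.
have /choice[c Fc] k : exists c, F (B c k).
  by apply: (pigeon k (val p ^ k)%N); apply: filterS FZ => x; exact: Zp_approx.
have cc m n : (m <= n)%N -> padic_abs p ((c n)%:R - (c m)%:R) <= (q ^+ m)^-1.
  move=> mn; have /filter_ex[x [xm xn]] : F (B (c m) m `&` B (c n) n).
    exact: filterI.
  rewrite -padic_norm_natB.
  rewrite -(subrK x (c n)%:R) -addrA; apply: padic_normD => //.
  rewrite -opprB padic_normN (le_trans xn)// lef_pV2 ?posrE ?exprn_gt0//.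
  by rewrite ler_weXn2l// ler1n prime_gt0.
have small (e : rat) : 0 < e -> exists k, (q ^+ k)^-1 < e.
  move=> e0; exists (Num.bound e^-1); rewrite -[ltRHS]invrK.
  rewrite ltf_pV2 ?posrE ?exprn_gt0 ?invr_gt0//.
  apply: (lt_le_trans (upper_nthrootP (leqnn _))).
  by rewrite lerXn2r ?nnegrE ?ler0n// ler_nat prime_gt1.
have aC : (fun n => (c n)%:R) \in @padic_cauchy p.
  apply/padic_cauchyP => e /small[k ke]; exists k => m n km kn.
  rewrite (le_lt_trans _ ke)// -(subrK (c k)%:R (c m)%:R) -addrA.
  rewrite (le_trans (padic_absD _ _ _))// ge_max cc//=.
  by rewrite -padic_absN opprB cc.
pose x := \pi_(Qp p)
  (exist (fun u => u \in padic_cauchy p) _ aC : padic_cauchy_seq p).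
have xB k : B (c k) k x.
  rewrite /B /= /x -(rmorph_nat \pi_(Qp p)) -rmorphB.
  apply: (@padic_norm_le _ _ _ k) => n kn.
  by rewrite valB_nat cc.
exists x; split.
  rewrite /Defs.Zp /= -(subrK (c 0%N)%:R x); apply: padic_normD.
    by rewrite (le_trans (xB 0%N))// invr1.
  exact: padic_norm_nat_le1.
move=> U /nbhs_ballP[e /= /small[k ke] eU].
apply: filterS (Fc k) => y yB; apply: eU; rewrite padic_ballE /=.
apply: le_lt_trans ke; rewrite -(subrK (c k)%:R x) -addrA.
by apply: padic_normD; [exact: xB|rewrite -opprB padic_normN].
Qed.

End Zp_compact.

(** * Schwartz functions *)

Section schwartz_algebra.
Variable R : realType.
Implicit Types (u v w : R -> R) (f g : R -> R[i]).

(** If the functions of P are differentiable with derivatives in P, then all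
    their iterated derivatives are in P; so decay need only be checked for the
    functions of P themselves. *)
Lemma real_schwartz_coind (P : set (R -> R)) :
  (forall u, P u -> [/\ forall x, derivable u x 1, P (derive1 u) &
     forall m, exists M, forall x, `|x ^+ m * u x| <= M]) ->
  P `<=` @real_schwartz R.
Proof.
move=> PS u Pu; have Pn n : P (derive1n n u).
  by elim: n => // n /PS[_ + _]; rewrite derive1nS.
by split=> [n x|m n]; have [] := PS _ (Pn n).
Qed.

(** The algebra generated by the Schwartz functions. By the Leibniz rule it is
    stable under derivation, which makes coinduction applicable to it and
    avoids formulas for the iterated derivatives of a product. *)
Inductive schwartz_generated : set (R -> R) :=
| gen_schwartz u : real_schwartz u -> schwartz_generated u
| gen_cstM (c : R) u : schwartz_generated u ->
    schwartz_generated (fun x => c * u x)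
| gen_add u v : schwartz_generated u -> schwartz_generated v ->
    schwartz_generated (fun x => u x + v x)
| gen_mul u v : schwartz_generated u -> schwartz_generated v ->
    schwartz_generated (fun x => u x * v x).

Lemma schwartz_generated_sub : schwartz_generated `<=` @real_schwartz R.
Proof.
apply: real_schwartz_coind => u; elim=> {u}.
- move=> u [ud ub]; split; first exact: (ud 0%N).
    by apply: gen_schwartz; split=> [n x|m n]; rewrite -derive1Sn.
  by move=> m; exact: (ub m 0%N).
- move=> c u _ [ud u' ub]; split.
  + by move=> x; apply: derivableM; [exact: derivable_cst|exact: ud].
  + rewrite (_ : derive1 _ = fun x => c * derive1 u x).
      exact: gen_cstM.
    apply/funext => x; rewrite !derive1E.
    exact: (deriveZ c (ud x)).
  + move=> m; have [M uM] := ub m; exists (`|c| * M) => x.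
    by rewrite mulrCA normrM ler_wpM2l.
- move=> u v _ [ud u' ub] _ [vd v' vb]; split.
  + by move=> x; exact: derivableD.
  + rewrite (_ : derive1 _ = fun x => derive1 u x + derive1 v x).
      exact: gen_add.
    apply/funext => x; rewrite !derive1E.
    exact: deriveD.
  + move=> m; have [M uM] := ub m; have [N vN] := vb m; exists (M + N) => x.
    by rewrite mulrDr (le_trans (ler_normD _ _))// lerD.
- move=> u v uP [ud u' ub] vP [vd v' vb]; split.
  + by move=> x; exact: derivableM.
  + rewrite (_ : derive1 _ = fun x => u x * derive1 v x + v x * derive1 u x).
      by apply: gen_add; apply: gen_mul.
    apply/funext => x; rewrite !derive1E.
    exact: deriveM.
  + move=> m; have [M uM] := ub m; have [N vN] := vb 0%N; exists (M * N) => x.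
    rewrite mulrA normrM ler_pM//.
    by have := vN x; rewrite expr0 mul1r.
Qed.

Lemma real_schwartz0 : @real_schwartz R (fun=> 0).
Proof.
apply: (@real_schwartz_coind [set (fun=> 0)]) => // _ ->; split=> //.
- by rewrite /set1 /=; apply/funext => x; exact: derive1_cst.
- by move=> m; exists 0 => x; rewrite mulr0 normr0.
Qed.

Lemma real_schwartz_cstM c u :
  real_schwartz u -> real_schwartz (fun x => c * u x).
Proof. by move=> uS; apply/schwartz_generated_sub/gen_cstM/gen_schwartz. Qed.

Lemma real_schwartzD u v : real_schwartz u -> real_schwartz v ->
  real_schwartz (fun x => u x + v x).
Proof.
move=> uS vS; apply/schwartz_generated_sub.
by apply: gen_add; exact: gen_schwartz.
Qed.

Lemma real_schwartzM u v : real_schwartz u -> real_schwartz v ->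
  real_schwartz (fun x => u x * v x).
Proof.
move=> uS vS; apply/schwartz_generated_sub.
by apply: gen_mul; exact: gen_schwartz.
Qed.

Lemma real_schwartzB u v : real_schwartz u -> real_schwartz v ->
  real_schwartz (fun x => u x - v x).
Proof.
move=> uS vS; under eq_fun do rewrite -mulN1r.
by apply: real_schwartzD => //; exact: real_schwartz_cstM.
Qed.

Lemma schwartz0 : @schwartz R (fun=> 0).
Proof. by split; exact: real_schwartz0. Qed.

Lemma schwartzD f g : schwartz f -> schwartz g -> schwartz (fun x => f x + g x).
Proof.
move=> [f1 f2] [g1 g2]; split.
  by under eq_fun do rewrite raddfD; exact: real_schwartzD.
by under eq_fun do rewrite raddfD; exact: real_schwartzD.
Qed.

Let ReM (a b : R[i]) : complex.Re (a * b) =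
  complex.Re a * complex.Re b - complex.Im a * complex.Im b.
Proof. by case: a b => [? ?] []. Qed.

Let ImM (a b : R[i]) : complex.Im (a * b) =
  complex.Re a * complex.Im b + complex.Im a * complex.Re b.
Proof. by case: a b => [? ?] []. Qed.

Lemma schwartzM f g : schwartz f -> schwartz g -> schwartz (fun x => f x * g x).
Proof.
move=> [f1 f2] [g1 g2]; split.
  by under eq_fun do rewrite ReM; apply: real_schwartzB; exact: real_schwartzM.
by under eq_fun do rewrite ImM; apply: real_schwartzD; exact: real_schwartzM.
Qed.

Lemma schwartz_cstM c f : schwartz f -> schwartz (fun x => c * f x).
Proof.
move=> [f1 f2]; split.
  under eq_fun do rewrite ReM.
  by apply: real_schwartzB; exact: real_schwartz_cstM.
under eq_fun do rewrite ImM.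
by apply: real_schwartzD; exact: real_schwartz_cstM.
Qed.

End schwartz_algebra.

(** * Local factors and the maximal compact subring *)

Section local_theory.
Variable R : realType.
Local Notation C := R[i].
Implicit Types v : place.

Definition integral_at v : set (Qv R v) :=
  match v with Some p => Zp p | None => setT end.

Lemma integral_at0 v : integral_at (0 : Qv R v).
Proof. by case: v => //= p; exact: Zp0. Qed.

Lemma integral_at1 v : integral_at (1 : Qv R v).
Proof. by case: v => //= p; exact: Zp1. Qed.

Lemma integral_atB v (a b : Qv R v) :
  integral_at a -> integral_at b -> integral_at (a - b).
Proof. by case: v a b => //= p; exact: ZpB. Qed.

Lemma integral_atM v (a b : Qv R v) :
  integral_at a -> integral_at b -> integral_at (a * b).
Proof. by case: v a b => //= p; exact: ZpM. Qed.

Lemma integral_at_compact v : v != infty -> compact (@integral_at v).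
Proof. by case: v => //= p _; exact: compact_Zp. Qed.

(** The norms of the powers of a are unbounded, whereas the norm is bounded on
    the unit ball around b. *)
Lemma powers_escape v (a b : Qv R v) : ~ integral_at a ->
  exists N (U : set (Qv R v)), nbhs b U /\ forall n, (N <= n)%N -> ~ U (a ^+ n).
Proof.
case: v a b => [p|] /= a b; last by move=> /(_ I).
rewrite /Defs.Zp /= => /negP; rewrite -ltNge => a1.
have normX n : padic_norm ((a : Qp p) ^+ n) = padic_norm a ^+ n.
  by elim: n => [|n IH]; rewrite ?expr0 ?padic_norm1// !exprS padic_normM IH.
(* Bernoulli's inequality: the norms of the powers of a grow at least
   linearly. *)
have bernoulli (t : rat) n : 0 < t -> n%:R * t <= (1 + t) ^+ n.
  move=> t0; elim: n => [|n IH]; first by rewrite mul0r expr0 ler01.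
  rewrite exprSr mulrDr mulr1 -natr1 mulrDl mul1r lerD//.
  by rewrite ler_peMl ?(ltW t0)// exprn_ege1// lerDl ltW.
have [k ak] : exists k, Num.max 1 (padic_norm b) < padic_norm a ^+ k.
  have d0 : 0 < padic_norm a - 1 by rewrite subr_gt0.
  set m := Num.max _ _; have m0 : 0 <= m by rewrite le_max ler01.
  exists (Num.bound (m / (padic_norm a - 1))).
  have := archi_boundP (divr_ge0 m0 (ltW d0)); rewrite ltr_pdivrMr// => mk.
  rewrite (lt_le_trans mk)//; set n := Num.bound _.
  by rewrite -[padic_norm a in leRHS](subrK 1) [_ - 1 + 1]addrC bernoulli.
exists k, (ball b 1); split; first exact: nbhsx_ballx.
move=> n kn; rewrite padic_ballE /= => bn.
have : padic_norm (a ^+ n) <= Num.max 1 (padic_norm b).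
  rewrite -(subrK b (a ^+ n)); apply: padic_normD.
    by rewrite -opprB padic_normN le_max ltW.
  by rewrite le_max lexx orbT.
apply/negP; rewrite -ltNge (lt_le_trans ak)// normX.
by rewrite ler_weXn2l// ltW.
Qed.

(** The powers of an element of K have a cluster point in K, so they cannot
    escape. *)
Lemma compact_subring_integral (S : {fset place}) (K : set (semilocal R S)) :
  compact K -> is_subring K -> forall x, K x ->
  forall v : S, integral_at (x v).
Proof.
move=> cK [K1 _ KM] x Kx v; apply: contrapT => xv.
pose xn n : semilocal R S := fun w => x w ^+ n.
have Kxn n : K (xn n).
  elim: n => [|n IH]; first exact: K1.
  have -> : xn n.+1 = fun w => x w * xn n w.
    by apply: functional_extensionality_dep => w; rewrite /xn exprS.
  exact: KM.
have xnK : \forall n \near \oo, K (xn n) by apply: nearW.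
have [y [_ yc]] := cK (xn @ \oo) _ xnK.
have [N [U [Uy UN]]] := @powers_escape _ _ (y v) xv.
have [||_ [[n Nn <-]]] := yc (xn @` [set n | (N <= n)%N]) (proj v @^-1` U).
- by exists N => // n /= Nn; exists n.
- exact: (@proj_continuous _ (fun w : S => Qv R (val w)) v).
- exact: UN.
Qed.

(** The product of the Zp is a compact subring that contains all the others, so
    it is the only maximal one. *)
Lemma max_compact_subringE (S : {fset place}) : infty \notin S ->
  @max_compact_subring R S =
  [set x : semilocal R S | forall v : S, integral_at (x v)].
Proof.
move=> S0; set Z : set (semilocal R S) := [set x | _].
have Zc : compact Z.
  apply: (@tychonoff S (fun v : S => Qv R (val v) : topologicalType)
    (fun v : S => @integral_at (val v))) => v.
  by apply: integral_at_compact; apply: contraNneq S0 => <-; exact: fsvalP.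
have Zr : is_subring Z.
  split=> [v|x y xZ yZ v|x y xZ yZ v].
  - exact: integral_at1.
  - exact: integral_atB.
  - exact: integral_atM.
have Zmax L : compact L -> is_subring L -> Z `<=` L -> L = Z.
  move=> cL rL ZL; apply/seteqP; split=> // x Lx.
  exact: compact_subring_integral Lx.
apply: xget_unique => // L [cL rL Lmax]; apply/esym/Lmax => //.
by move=> x Lx; exact: compact_subring_integral Lx.
Qed.

(** The factor 1_{Z_p} that pure tensors have at almost all p. The choice at
    infinity is arbitrary among the Schwartz functions. *)
Definition unramified v : Qv R v -> C :=
  match v with Some p => \1_(Zp p) | None => fun=> 0 end.

Lemma unramifiedE v (a : Qv R v) : v != infty ->
  unramified a = \1_(@integral_at v) a.
Proof. by case: v a. Qed.

Lemma local_bruhat_schwartz_unramified v :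
  local_bruhat_schwartz (@unramified v).
Proof.
case: v => [p|]; last exact: schwartz0.
split=> /=.
  move=> x; have := near_Zp x; apply: filterS => y h.
  rewrite !indicE; congr (nat_of_bool _)%:R.
  by apply/idP/idP; rewrite !inE => /h.
rewrite /compactly_supported /= (_ : [set _ | _] = Zp p).
  by rewrite -(closure_id _).1; [exact: compact_Zp|exact: Zp_closed].
by apply/seteqP; split=> x /=; rewrite indicE pnatr_eq0 eqb0 negbK inE.
Qed.

Lemma local_bruhat_schwartzM v (f g : Qv R v -> C) :
  local_bruhat_schwartz f -> local_bruhat_schwartz g ->
  local_bruhat_schwartz (fun x => f x * g x).
Proof.
case: v f g => [p|] f g; last exact: schwartzM.
move=> [fl fc] [gl _]; split=> [x|].
  by apply: filterS2 (fl x) (gl x) => y -> ->.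
apply: subclosed_compact fc _; first exact: closed_closure.
by apply: closureS => x /=; apply: contra_neq => ->; rewrite mul0r.
Qed.

End local_theory.

(** * Linear spans and algebras of functions *)

Section linear_span_theory.
Variables (R : realType) (T : Type).
Local Notation C := R[i].
Implicit Types (P Q : set (T -> C)) (f g : T -> C).

Lemma scale_fctE (a : C) f : a *: f = fun x => a * f x.
Proof. by []. Qed.

Lemma scale_fctAl (a : C) f g : (a *: f) * g = a *: (f * g).
Proof. by apply/funext => x; exact: esym (mulrA _ _ _). Qed.

Lemma linear_span_ind P Q : Q 0 -> (forall f g, Q f -> Q g -> Q (f + g)) ->
  (forall a f, Q f -> Q (a *: f)) -> P `<=` Q -> linear_span P `<=` Q.
Proof.
move=> Q0 QD QZ PQ _ [n [c [g [Pg ->]]]].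
by elim/big_ind: _ => // i _; exact/QZ/PQ.
Qed.

Lemma linear_span0 P : linear_span P 0.
Proof.
by exists 0%N, (fun=> 0), (fun=> 0); split=> [[]//|]; rewrite big_ord0.
Qed.

Lemma linear_span_gen P f : P f -> linear_span P f.
Proof.
move=> Pf; exists 1%N, (fun=> 1), (fun=> f); split=> //.
by rewrite big_ord1 scale1r.
Qed.

Lemma linear_spanZ P a f : linear_span P f -> linear_span P (a *: f).
Proof.
move=> [n [c [g [Pg ->]]]]; exists n, (fun i => a * c i), g; split=> //.
by rewrite scaler_sumr; apply: eq_bigr => i _; rewrite scalerA.
Qed.

Lemma linear_spanD P f g :
  linear_span P f -> linear_span P g -> linear_span P (f + g).
Proof.
move=> [n [c [u [Pu ->]]]] [m [d [v [Pv ->]]]].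
exists (n + m)%N,
  (fun i => match fintype.split i with inl j => c j | inr j => d j end),
  (fun i => match fintype.split i with inl j => u j | inr j => v j end); split.
  by move=> i; case: fintype.split.
rewrite big_split_ord /=; congr (_ + _); apply: eq_bigr => i _.
  by rewrite (unsplitK (inl i)).
by rewrite (unsplitK (inr i)).
Qed.

Lemma linear_spanM P : (forall f g, P f -> P g -> P (f * g)) ->
  forall f g, linear_span P f -> linear_span P g -> linear_span P (f * g).
Proof.
move=> PM f g Pf Pg; move: f Pf; apply: linear_span_ind.
- by rewrite mul0r; exact: linear_span0.
- by move=> f h fP hP; rewrite mulrDl; exact: linear_spanD.
- by move=> a f fP; rewrite scale_fctAl; exact: linear_spanZ.
move=> f Pf; move: g Pg; apply: linear_span_ind.
- by rewrite mulr0; exact: linear_span0.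
- by move=> g h gP hP; rewrite mulrDr; exact: linear_spanD.
- by move=> a g gP; rewrite mulrC scale_fctAl mulrC; exact: linear_spanZ.
- by move=> g Pg; apply/linear_span_gen/PM.
Qed.

Lemma function_algebraP P : P 0 -> (forall f g, P f -> P g -> P (f + g)) ->
  (forall a f, P f -> P (a *: f)) -> (forall f g, P f -> P g -> P (f * g)) ->
  is_algebra (function_algebra P).
Proof.
move=> P0 PD PZ PM; split=> //=.
- by move=> f Pf; rewrite -scaleN1r; exact: PZ.
- by move=> *; exact: addrA.
- by move=> *; exact: addrC.
- by move=> *; exact: add0r.
- by move=> *; exact: addNr.
- by move=> *; exact: scalerA.
- by move=> *; exact: scale1r.
- by move=> *; exact: scalerDr.
- by move=> *; exact: scalerDl.
- by move=> *; exact: mulrA.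
- by move=> *; exact: mulrC.
- by move=> *; exact: mulrDl.
- by move=> *; rewrite scale_fctAl.
Qed.

End linear_span_theory.

(** * The maps gamma on points *)

Section total_points.
Variable R : realType.
Local Notation C := R[i].
Implicit Types (S T : {fset place}) (v : place).

Definition point := forall v, Qv R v.
Implicit Type X : point.

Definition trunc S X : semilocal R S := fun v : S => X (val v).
Arguments trunc : clear implicits.

(** Any default value that is integral at all places would do in place of 0. *)
Definition extend S (x : semilocal R S) : point := fun v =>
  if pselect (v \in S) is left vS then x [` vS]%fset else 0.

Lemma extend_in S (x : semilocal R S) (v : S) : extend x (val v) = x v.
Proof.
case: v => v vS; rewrite /extend /=.
case: pselect => [vS'|]; last by rewrite vS.
by rewrite (bool_irrelevance vS vS').
Qed.

Lemma extend_out S (x : semilocal R S) v : v \notin S -> extend x v = 0.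
Proof. by move=> /negP vS; rewrite /extend; case: pselect. Qed.

Lemma extendK S (x : semilocal R S) : trunc S (extend x) = x.
Proof. by apply: functional_extensionality_dep => v; exact: extend_in. Qed.

Lemma trunc_ext S X Y :
  (forall v, v \in S -> X v = Y v) -> trunc S X = trunc S Y.
Proof.
move=> XY; apply: functional_extensionality_dep => v.
by rewrite /trunc XY ?fsvalP.
Qed.

Lemma eq_on_trunc S (f g : semilocal R S -> C) :
  (forall X, f (trunc S X) = g (trunc S X)) -> f = g.
Proof. by move=> fg; apply/funext => x; rewrite -(extendK x). Qed.

Definition integral_outside S T : set point :=
  [set X | forall v, v \in T -> v \notin S -> integral_at (X v)].

Lemma gamma_trunc S T (ST : (S `<=` T)%fset) f X : infty \in S ->
  gamma ST f (trunc T X) = \1_(integral_outside S T) X * f (trunc S X).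
Proof.
move=> S0; rewrite /gamma max_compact_subringE ?inE ?S0//.
congr (_ * _).
rewrite !indicE; congr (nat_of_bool _)%:R; apply/idP/idP; rewrite !inE /= => h.
  move=> v vT vS; have vTS : v \in (T `\` S)%fset by rewrite inE vS.
  exact: (h [` vTS]%fset).
move=> [v vTS]; rewrite /semilocal_proj /trunc /=.
by apply: h; move: vTS; rewrite inE => /andP[].
Qed.

End total_points.
Arguments trunc {R} S X.

Lemma natr_boolM (K : comNzRingType) (b : bool) (y z : K) :
  b%:R * (y * z) = (b%:R * y) * (b%:R * z).
Proof. by case: b; rewrite ?mul1r// !mul0r. Qed.

Section gamma_theory.
Variable R : realType.
Local Notation C := R[i].
Implicit Types (S T U : {fset place}) (v : place) (X : point R).

Lemma gammaD S T (ST : (S `<=` T)%fset) (f g : semilocal R S -> C) :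
  gamma ST (f + g) = gamma ST f + gamma ST g.
Proof. by apply/funext => x; exact: mulrDr. Qed.

Lemma gammaZ S T (ST : (S `<=` T)%fset) a (f : semilocal R S -> C) :
  gamma ST (a *: f) = a *: gamma ST f.
Proof. by apply/funext => x; exact: mulrCA. Qed.

Lemma gamma0 S T (ST : (S `<=` T)%fset) : gamma ST (0 : semilocal R S -> C) = 0.
Proof. by apply/funext => x; exact: mulr0. Qed.

Lemma gammaM S T (ST : (S `<=` T)%fset) (f g : semilocal R S -> C) :
  gamma ST (f * g) = gamma ST f * gamma ST g.
Proof. by apply/funext => x; exact: natr_boolM. Qed.

Lemma gamma_id S (SS : (S `<=` S)%fset) (f : semilocal R S -> C) :
  infty \in S -> gamma SS f = f.
Proof.
move=> S0; apply: eq_on_trunc => X; rewrite gamma_trunc// indicE.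
by rewrite mem_set ?mul1r// => v ->.
Qed.

Lemma gamma_comp S T U (ST : (S `<=` T)%fset) (TU : (T `<=` U)%fset)
    (SU : (S `<=` U)%fset) (f : semilocal R S -> C) :
  infty \in S -> gamma TU (gamma ST f) = gamma SU f.
Proof.
move=> S0; have T0 : infty \in T by exact: (fsubsetP ST).
apply: eq_on_trunc => X; rewrite !gamma_trunc// mulrA; congr (_ * _).
rewrite -[LHS]/((\1_ _ \* \1_ _) X) -indicI; congr (\1__ _).
apply/seteqP; split=> Y.
  move=> [YTU YST] v vU vS; have [vT|vT] := boolP (v \in T); first exact: YST.
  exact: YTU.
move=> Yh; split=> v vT vS.
  by apply: Yh => //; apply: contra vS; exact: (fsubsetP ST).
by apply: Yh => //; exact: (fsubsetP TU).
Qed.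

(** An element of A_S extends to a point that is integral outside S, where
    gamma does not change the value of a function. *)
Lemma gamma_inj S T (ST : (S `<=` T)%fset) : infty \in S ->
  injective (@gamma R S T ST).
Proof.
move=> S0 f g fg; apply/funext => x.
have := congr1 (@^~ (trunc T (extend x))) fg.
rewrite !gamma_trunc// extendK indicE mem_set ?mul1r// => v _ vS.
by rewrite extend_out//; exact: integral_at0.
Qed.

(** * Pure tensors and Bruhat-Schwartz functions *)

Definition tensor S (h : forall v, Qv R v -> C) : semilocal R S -> C :=
  fun x => \prod_(v : S) h (val v) (x v).

Lemma tensor_trunc S (h : forall v, Qv R v -> C) X :
  tensor h (trunc S X) = \prod_(v <- S) h v (X v).
Proof. by rewrite big_seq_fsetE. Qed.

(** Families indexed by all places, rather than by S, make it possible to use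
    the same family of local functions for several S. *)
Lemma bruhat_schwartzE S : @bruhat_schwartz R S =
  linear_span [set f | exists2 h : forall v, Qv R v -> C,
    forall v, local_bruhat_schwartz (h v) & f = tensor h].
Proof.
rewrite /bruhat_schwartz; congr linear_span; apply/seteqP; split=> f [h hP ->].
  pose k v : Qv R v -> C :=
    if pselect (v \in S) is left vS then h [` vS]%fset else @unramified R v.
  exists k => [v|].
    rewrite /k; case: pselect => [vS|_]; first exact: (hP [` vS]%fset).
    exact: local_bruhat_schwartz_unramified.
  apply/funext => x; apply: eq_bigr => -[v vS] _; rewrite /k /=.
  by case: pselect => // vS'; rewrite (bool_irrelevance vS vS').
by exists (fun v : S => h (val v)).
Qed.

Lemma bruhat_schwartz_tensor S h :
  (forall v, local_bruhat_schwartz (h v)) -> @bruhat_schwartz R S (tensor h).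
Proof.
by move=> hP; rewrite bruhat_schwartzE; apply: linear_span_gen; exists h.
Qed.

Lemma bruhat_schwartz_ind S (Q : set (semilocal R S -> C)) :
  Q 0 -> (forall f g, Q f -> Q g -> Q (f + g)) ->
  (forall a f, Q f -> Q (a *: f)) ->
  (forall h, (forall v, local_bruhat_schwartz (h v)) -> Q (tensor h)) ->
  @bruhat_schwartz R S `<=` Q.
Proof.
move=> Q0 QD QZ Qt; rewrite bruhat_schwartzE; apply: linear_span_ind => //.
by move=> _ [h hP ->]; exact: Qt.
Qed.

Lemma bruhat_schwartz0 S : @bruhat_schwartz R S 0.
Proof. exact: linear_span0. Qed.

Lemma bruhat_schwartzD S f g : @bruhat_schwartz R S f ->
  @bruhat_schwartz R S g -> @bruhat_schwartz R S (f + g).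
Proof. exact: linear_spanD. Qed.

Lemma bruhat_schwartzZ S a f : @bruhat_schwartz R S f ->
  @bruhat_schwartz R S (a *: f).
Proof. exact: linear_spanZ. Qed.

Lemma bruhat_schwartzM S f g : @bruhat_schwartz R S f ->
  @bruhat_schwartz R S g -> @bruhat_schwartz R S (f * g).
Proof.
rewrite bruhat_schwartzE; apply: linear_spanM => {f g}_ _ [h hP ->] [k kP ->].
exists (fun v x => h v x * k v x) => [v|]; first exact: local_bruhat_schwartzM.
by apply/funext => x; rewrite /tensor big_split.
Qed.

Lemma bruhat_schwartz_algebra S :
  is_algebra (function_algebra (@bruhat_schwartz R S)).
Proof.
apply: function_algebraP.
- exact: bruhat_schwartz0.
- exact: bruhat_schwartzD.
- exact: bruhat_schwartzZ.
- exact: bruhat_schwartzM.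
Qed.

(** At finite places the factors are the indicators of the integral elements;
    the real place is kept out of the product by being in S. *)
Lemma prod_unramified S X (s : seq place) : infty \in S ->
  \prod_(v <- s) (if v \in S then 1 else unramified (X v)) =
  \1_[set Y : point R | forall v, v \in s -> v \notin S -> integral_at (Y v)] X.
Proof.
move=> S0; rewrite indicE; case: (boolP (X \in _)); rewrite ?inE /= => Xi.
  rewrite big1_seq// => v /= vs; case: ifPn => // vS.
  rewrite unramifiedE; first by rewrite indicE mem_set//; exact: Xi.
  by apply: contraNneq vS => ->.
move: Xi; rewrite notin_setE /= => /existsNP[v].
move=> /not_implyP[vs] /not_implyP[vS vX].
rewrite (perm_big _ (perm_to_rem vs)) big_cons /= (negbTE vS) unramifiedE.
  by rewrite indicE memNset// mulr0n mul0r.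
by apply: contraNneq vS => ->.
Qed.

Lemma prod_fset_incl S T (F : place -> C) : (S `<=` T)%fset ->
  \prod_(v <- S) F v = \prod_(v <- T) (if v \in S then F v else 1).
Proof.
move=> ST; rewrite -(big_fset_incl _ ST); first last.
  by move=> v _ /negbTE ->.
by apply: eq_big_seq => v ->.
Qed.

Lemma gamma_tensor S T (ST : (S `<=` T)%fset) (h : forall v, Qv R v -> C) :
  infty \in S ->
  gamma ST (tensor h) =
  tensor (fun v => if v \in S then h v else @unramified R v).
Proof.
move=> S0; apply: eq_on_trunc => X; rewrite gamma_trunc// !tensor_trunc.
rewrite -prod_unramified// (prod_fset_incl _ ST) -big_split /=.
by apply: eq_bigr => v _; case: ifP; rewrite ?mul1r ?mulr1.
Qed.

Lemma gamma_bruhat_schwartz S T (ST : (S `<=` T)%fset) f : infty \in S ->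
  bruhat_schwartz f -> bruhat_schwartz (@gamma R S T ST f).
Proof.
move=> S0; move: f; apply: bruhat_schwartz_ind => [|f g|a f|h hP].
- by rewrite gamma0; exact: bruhat_schwartz0.
- by rewrite gammaD; exact: bruhat_schwartzD.
- by rewrite gammaZ; exact: bruhat_schwartzZ.
rewrite gamma_tensor//; apply: bruhat_schwartz_tensor => v.
by case: ifP => // _; exact: local_bruhat_schwartz_unramified.
Qed.

(** Freezing the coordinates outside S at 0 turns the factors of a pure tensor
    at the places of T outside S into constants. *)
Lemma bruhat_schwartz_freeze S T (ST : (S `<=` T)%fset) f :
  @bruhat_schwartz R T f ->
  bruhat_schwartz (fun y : semilocal R S => f (trunc T (extend y))).
Proof.
move: f; apply: bruhat_schwartz_ind => [|f g|a f|h hP].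
- exact: bruhat_schwartz0.
- exact: bruhat_schwartzD.
- exact: bruhat_schwartzZ.
pose c := \prod_(v <- T) (if v \in S then 1 else h v 0).
rewrite (_ : (fun y => _) = c *: tensor h).
  by apply: bruhat_schwartzZ; exact: bruhat_schwartz_tensor.
apply/funext => y; rewrite scale_fctE tensor_trunc -[in RHS](extendK y).
rewrite tensor_trunc (prod_fset_incl _ ST) -big_split /=; apply: eq_bigr => v _.
by case: ifPn => vS; rewrite ?mul1r// mulr1 extend_out.
Qed.

End gamma_theory.
Arguments tensor {R} S h _.

(** * Descent along gamma *)

Section descent.
Variable R : realType.
Local Notation C := R[i].
Implicit Types (S T : {fset place}) (v w : place) (X : point R).

Definition zero_on (D : seq place) X : point R :=
  fun w => if w \in D then 0 else X w.

(** This identity says that f is the tensor product of 1_{Z_v} with a function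
    of the other coordinates. *)
Definition unramified_at S v (f : semilocal R S -> C) := forall X,
  f (trunc S X) = \1_(@integral_at R v) (X v) * f (trunc S (zero_on [:: v] X)).

(** By the equation, the value of f at an element of A_{S1} is a product of two
    factors: a value of g, which does not involve the coordinate at v, and an
    integrality condition at the places outside S2, of which v is one. *)
Lemma gamma_eq_unramified_at S1 S2 T (S1T : (S1 `<=` T)%fset)
    (S2T : (S2 `<=` T)%fset) (f : semilocal R S1 -> C)
    (g : semilocal R S2 -> C) v :
  infty \in S1 -> infty \in S2 -> v \in S1 -> v \notin S2 ->
  gamma S1T f = gamma S2T g -> unramified_at v f.
Proof.
move=> S10 S20 v1 v2 fg X.
have fE Y : f (trunc S1 Y) = \1_(integral_outside S2 T) (extend (trunc S1 Y)) *
    g (trunc S2 (extend (trunc S1 Y))).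
  rewrite -gamma_trunc// -fg gamma_trunc// extendK indicE mem_set ?mul1r//.
  by move=> w _ w1; rewrite extend_out//; exact: integral_at0.
have offv w : w != v ->
    extend (trunc S1 X) w = extend (trunc S1 (zero_on [:: v] X)) w.
  move=> wv; rewrite /extend; case: pselect => // w1.
  by rewrite /trunc /zero_on /= inE (negbTE wv).
have atv Y : extend (trunc S1 Y) v = Y v by exact: (extend_in _ [` v1]%fset).
rewrite !fE mulrA; congr (_ * _); last first.
  by congr g; apply: trunc_ext => w w2; apply: offv; apply: contraNneq v2 => <-.
rewrite -[RHS]natrM; congr (_%:R); rewrite mulnb; congr nat_of_bool.
apply/idP/andP; rewrite !inE /=; [move=> XI|move=> [Xv XI] w wT w2].
  split; first by rewrite -atv; apply: XI => //; exact: (fsubsetP S1T).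
  move=> w wT w2; have [->|wv] := eqVneq w v.
    by rewrite atv /zero_on inE eqxx; exact: integral_at0.
  by rewrite -offv//; exact: XI.
by have [->|wv] := eqVneq w v; [rewrite atv|rewrite offv//; exact: XI].
Qed.

Lemma unramified_atS S (f : semilocal R S -> C) (D : seq place) :
  (forall v, v \in D -> unramified_at v f) -> forall X,
  f (trunc S X) =
  \1_[set Y : point R | forall v, v \in D -> integral_at (Y v)] X *
    f (trunc S (zero_on D X)).
Proof.
elim: D => [|v D IH] fD X.
  rewrite indicE mem_set ?mul1r//.
rewrite IH => [|w wD]; last by apply: fD; rewrite inE wD orbT.
rewrite (fD v) ?mem_head// mulrA; congr (_ * f _); last first.
  by apply: trunc_ext => w _; rewrite /zero_on !inE; case: eqP.
rewrite -[LHS]natrM; congr (_%:R); rewrite mulnb; congr nat_of_bool.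
apply/andP/idP; rewrite !inE /=; [move=> [XD Xv] w|move=> XD].
  rewrite inE => /predU1P[->|]; last exact: XD.
  by move: Xv; rewrite /zero_on; case: ifPn => // + _; exact: XD.
split=> [w wD|]; first by apply: XD; rewrite inE wD orbT.
rewrite /zero_on; case: ifP => _; first exact: integral_at0.
by apply: XD; exact: mem_head.
Qed.

Lemma gamma_descent S T (ST : (S `<=` T)%fset) (f : semilocal R T -> C) :
  infty \in S -> (forall v, v \in T -> v \notin S -> unramified_at v f) ->
  f = gamma ST (fun y => f (trunc T (extend y))).
Proof.
move=> S0 fu; apply: eq_on_trunc => X; rewrite gamma_trunc//.
rewrite (@unramified_atS _ _ (T `\` S)%fset) => [|v]; last first.
  by rewrite inE => /andP[vS vT]; exact: fu.
congr (_ * f _).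
  congr (\1__ _); apply/seteqP; split=> Y Yi v.
    by move=> vT vS; apply: Yi; rewrite inE vS.
  by rewrite inE => /andP[vS vT]; exact: Yi.
apply: trunc_ext => v vT; rewrite /zero_on inE vT andbT.
have [vS|vS] := boolP (v \in S); first by rewrite (extend_in _ [` vS]%fset).
by rewrite extend_out.
Qed.

End descent.

(** * The sheaf property *)

Section sheaf.
Variable R : realType.
Local Notation C := R[i].
Local Notation F := (schwartz_sheaf R).
Implicit Types (U V W : opens SpecZ) (p : prime_number).

Lemma generic_in U : U !=set0 -> opens_set U generic_point.
Proof.
by move=> U0; rewrite -(places_ofK U0); exact: generic_complement.
Qed.

Lemma infty_in U : U !=set0 -> infty \in places_of U.
Proof. by move=> /places_of_infty; rewrite fsub1set. Qed.

Lemma in_places_of U p : U !=set0 ->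
  finite_place p \in places_of U <-> ~ opens_set U (closed_point p).
Proof.
move=> U0; rewrite in_fset_set ?inE; last exact: places_set_finite.
split=> [[//|[q /= + [<-]]//]|Up]; by right; exists p.
Qed.

Lemma schwartz_sectionsE U : U !=set0 ->
  @schwartz_sections R U = @bruhat_schwartz R (places_of U).
Proof. by rewrite /schwartz_sections; case: pselect. Qed.

Lemma schwartz_sections0 U : ~ (U !=set0) -> @schwartz_sections R U = [set 0].
Proof. by rewrite /schwartz_sections; case: pselect. Qed.

Lemma schwartz_restrE U V (VU : V `<=` U)
    (h : (places_of U `<=` places_of V)%fset) f :
  V !=set0 -> @schwartz_restr R U V VU f = gamma h f.
Proof.
move=> V0; rewrite /schwartz_restr; case: pselect => // V0'.
by rewrite (bool_irrelevance h (places_of_sub VU V0')).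
Qed.

Lemma schwartz_restr0 U V (VU : V `<=` U) f :
  ~ (V !=set0) -> @schwartz_restr R U V VU f = 0.
Proof. by move=> V0; rewrite /schwartz_restr; case: pselect. Qed.

Lemma schwartz_presheaf : is_presheaf_of_algebras F.
Proof.
split.
- move=> U; have [U0|U0] := pselect (U !=set0).
    by rewrite /= schwartz_sectionsE//; exact: bruhat_schwartz_algebra.
  rewrite /= schwartz_sections0//; apply: function_algebraP => //.
  + by move=> _ _ -> ->; rewrite /= addr0.
  + by move=> a _ ->; rewrite /= scaler0.
  + by move=> _ _ -> ->; rewrite /= mul0r.
- move=> U V VU; have [V0|V0] := pselect (V !=set0).
    have U0 : U !=set0 by case: V0 => P /VU; exists P.
    have UV := places_of_sub VU V0; split=> /=.
    + move=> f; rewrite !schwartz_sectionsE// (schwartz_restrE _ UV)//.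
      by apply: gamma_bruhat_schwartz; exact: infty_in.
    + by move=> f g _ _; rewrite !(schwartz_restrE _ UV)// gammaD.
    + by move=> a f _; rewrite !(schwartz_restrE _ UV)// gammaZ.
    + by move=> f g _ _; rewrite !(schwartz_restrE _ UV)// gammaM.
  split=> /=.
  + by move=> f _; rewrite schwartz_restr0// schwartz_sections0.
  + by move=> f g _ _; rewrite !schwartz_restr0// addr0.
  + by move=> a f _; rewrite !schwartz_restr0// scaler0.
  + by move=> f g _ _; rewrite !schwartz_restr0// mul0r.
- move=> U UU f /=; have [U0|U0] := pselect (U !=set0).
    move=> _; rewrite (schwartz_restrE _ (fsubset_refl _))// gamma_id//.
    exact: infty_in.
  by rewrite schwartz_sections0// => ->; rewrite schwartz_restr0.
- move=> U V W VU WV WU f _ /=; have [W0|W0] := pselect (W !=set0); last first.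
    by rewrite !schwartz_restr0.
  have V0 : V !=set0 by case: W0 => P /WV; exists P.
  have U0 : U !=set0 by case: V0 => P /VU; exists P.
  rewrite (schwartz_restrE _ (places_of_sub VU V0))//.
  rewrite (schwartz_restrE _ (places_of_sub WV W0))//.
  rewrite (schwartz_restrE _ (places_of_sub WU W0))//.
  by apply: gamma_comp; exact: infty_in.
Qed.

Lemma schwartz_is_sheaf : is_sheaf_of_algebras F.
Proof.
split; first exact: schwartz_presheaf.
  move=> U I V VU s t UV /= sP tP st.
  have [U0|U0] := pselect (U !=set0); last first.
    by move: sP tP; rewrite schwartz_sections0// => -> ->.
  have [P UP] := U0; have [i _ ViP] := UV _ UP.
  have V0 : V i !=set0 by exists P.
  have h := places_of_sub (VU i) V0.
  have := st i; rewrite !(schwartz_restrE _ h)// => /gamma_inj.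
  by apply; exact: infty_in.
move=> U I V VU s UV /= sP ss; have [U0|U0] := pselect (U !=set0); last first.
  exists 0; first by rewrite schwartz_sections0.
  move=> i; have Vi0 : ~ (V i !=set0) by move=> [P /VU UP]; apply: U0; exists P.
  by rewrite schwartz_restr0//; have := sP i; rewrite schwartz_sections0.
have U_infty := infty_in U0.
have VI i j : V i !=set0 -> V j !=set0 -> opensI (V i) (V j) !=set0.
  by move=> Vi Vj; exists generic_point; split; exact: generic_in.
have [P UP] := U0; have [k _ VkP] := UV _ UP; have Vk : V k !=set0 by exists P.
have UVk := places_of_sub (VU k) Vk.
have sk_unramified v : v \in places_of (V k) -> v \notin places_of U ->
    unramified_at v (s k).
  case: v => [p|_]; last by rewrite U_infty.
  move=> po /negP pU; have [i _ Vip] : (\bigcup_i V i) (closed_point p).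
    apply: UV; apply: contrapT => Up; apply: pU; exact/(in_places_of _ U0).
  have Vi : V i !=set0 by exists (closed_point p).
  have pVi : finite_place p \notin places_of (V i).
    by apply/negP => /(in_places_of _ Vi).
  have := ss k i; have W0 := VI _ _ Vk Vi.
  rewrite (schwartz_restrE _ (places_of_sub (opensIl _ _) W0))//.
  rewrite (schwartz_restrE _ (places_of_sub (opensIr _ _) W0))//.
  by apply: gamma_eq_unramified_at => //; exact: infty_in.
(* Outside the places of U, all coordinates are set to 0. *)
pose t (y : semilocal R (places_of U)) := s k (trunc _ (extend y)).
have skt : s k = gamma UVk t by exact: gamma_descent.
exists t.
  rewrite schwartz_sectionsE//; apply: bruhat_schwartz_freeze => //.
  by have := sP k; rewrite schwartz_sectionsE.
move=> i; have [Vi|Vi] := pselect (V i !=set0); last first.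
  by rewrite schwartz_restr0//; have := sP i; rewrite schwartz_sections0.
have W0 := VI _ _ Vk Vi; have := ss k i.
have hl := places_of_sub (@opensIl _ (V k) (V i)) W0.
have hr := places_of_sub (@opensIr _ (V k) (V i)) W0.
have hi := places_of_sub (VU i) Vi.
(* On the intersection of V k and V i, both s i and the restriction of t become
   the image of t, and gamma is injective. *)
rewrite !(schwartz_restrE _ hl, schwartz_restrE _ hr, schwartz_restrE _ hi)//.
rewrite skt (gamma_comp _ _ (fsubset_trans hi hr))//.
rewrite -(gamma_comp hi hr)// => /gamma_inj; apply; exact: infty_in.
Qed.

End sheaf.

(** * Bruhat-Schwartz functions on the adeles *)

Section adelic.
Variable R : realType.
Local Notation C := R[i].
Implicit Types (S T : {fset place}) (v : place) (p : prime_number).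
Implicit Types (x : adele R).

Lemma places_above (D : set prime_number) : finite_set D ->
  exists2 S : {fset place}, infty \in S &
    forall p, finite_place p \in S <-> D p.
Proof.
move=> fD; exists (infty |` fset_set (finite_place @` D))%fset => [|p].
  by rewrite !inE eqxx.
rewrite !inE /= in_fset_set ?inE; last exact: finite_image.
by split=> [[q Dq [<-]]//|Dp]; exists p.
Qed.

Lemma adelic_extensionD S (f g : semilocal R S -> C) :
  adelic_extension (f + g) = adelic_extension f + adelic_extension g.
Proof. by apply/funext => x; exact: mulrDr. Qed.

Lemma adelic_extensionZ S a (f : semilocal R S -> C) :
  adelic_extension (a *: f) = a *: adelic_extension f.
Proof. by apply/funext => x; exact: mulrCA. Qed.

Lemma adelic_extensionN S (f : semilocal R S -> C) :
  adelic_extension (- f) = - adelic_extension f.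
Proof. by apply/funext => x; exact: mulrN. Qed.

Lemma adelic_extension0 S : adelic_extension (0 : semilocal R S -> C) = 0.
Proof. by apply/funext => x; exact: mulr0. Qed.

Lemma adelic_extensionM S (f g : semilocal R S -> C) :
  adelic_extension (f * g) = adelic_extension f * adelic_extension g.
Proof. by apply/funext => x; exact: natr_boolM. Qed.

Lemma adelic_extension_gamma S T (ST : (S `<=` T)%fset)
    (f : semilocal R S -> C) :
  infty \in S -> adelic_extension (gamma ST f) = adelic_extension f.
Proof.
move=> S0; apply/funext => x; rewrite /adelic_extension.
rewrite -[adele_proj x]/(trunc T (sval x)) gamma_trunc// mulrA; congr (_ * _).
rewrite -[LHS]natrM; congr (_%:R); rewrite mulnb; congr nat_of_bool.
apply/andP/idP; rewrite !inE /=; [move=> [xT xST] p pS|move=> xS].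
  have [pT|pT] := boolP (finite_place p \in T); last exact: xT.
  exact: (xST _ pT pS).
split=> [p pT|[p|] vT vS //]; apply: xS => //.
by apply: contra pT; exact: (fsubsetP ST).
Qed.

Lemma extend_adele S (y : semilocal R S) :
  finite_set [set p | ~ Zp p (extend y (finite_place p))].
Proof.
apply: (@sub_finite_set _ _ (finite_place @^-1` [set` S])).
  move=> p /= yp; apply: contrapT => /negP pS; apply: yp.
  by rewrite extend_out//; exact: Zp0.
apply: finite_preimage; last exact: finite_fset.
by move=> p q _ _ [].
Qed.

Lemma adelic_extension_inj S : injective (@adelic_extension R S).
Proof.
move=> f g fg; apply/funext => y.
have := congr1 (@^~ (exist _ (extend y) (extend_adele y) : adele R)) fg.
rewrite /adelic_extension -[adele_proj _]/(trunc S (extend y)) extendK.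
rewrite indicE mem_set ?mul1r// => p pS /=.
by rewrite extend_out//; exact: Zp0.
Qed.

(** At a given adele, the product reduces to the places of S and those where the
    adele is not integral; by [prod_unramified] the latter only contribute an
    integrality condition. *)
Lemma adelic_tensorE S (h : forall v, Qv R v -> C) x : infty \in S ->
  (forall p, finite_place p \notin S -> h (finite_place p) = \1_(Zp p)) ->
  \big[*%R/1]_(v \in setT) h v (sval x v) = adelic_extension (tensor S h) x.
Proof.
move=> S0 hS; have [T T0 TE] := places_above (svalP x).
have ST := fsubsetUl S T.
rewrite (@fsbigTE _ _ _ _ (S `|` T)%fset) => [|v].
  have -> : \prod_(v <- (S `|` T)%fset) h v (sval x v) =
      \prod_(v <- (S `|` T)%fset)
        (if v \in S then 1 else unramified (sval x v)) *
      \prod_(v <- S) h v (sval x v).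
    rewrite (prod_fset_incl _ ST) -big_split /=; apply: eq_bigr => v _.
    case: ifPn; rewrite ?mul1r// mulr1 => vS.
    by case: v vS => [p pS|]; [rewrite hS|rewrite S0].
  rewrite prod_unramified// -tensor_trunc; congr (_ * _).
  rewrite !indicE; congr (nat_of_bool _)%:R.
  apply/idP/idP; rewrite !inE /= => xi.
    move=> p pS; apply: contrapT => /[dup] /TE pT; apply.
    by apply: (xi (finite_place p)) => //; rewrite inE pT orbT.
  by move=> [p|] // _ pS; exact: xi.
rewrite inE negb_or => /andP[vS vT]; case: v vS vT => [p|]; last by rewrite S0.
move=> pS pT; rewrite hS// indicE mem_set//; apply: contrapT => /TE.
by move=> h'; rewrite h' in pT.
Qed.

Lemma adelic_extension_bruhat_schwartz S f : infty \in S ->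
  @bruhat_schwartz R S f -> adelic_bruhat_schwartz (adelic_extension f).
Proof.
move=> S0; move: f; apply: bruhat_schwartz_ind => [|f g|a f|h hP].
- by rewrite adelic_extension0; exact: linear_span0.
- by rewrite adelic_extensionD; exact: linear_spanD.
- by rewrite adelic_extensionZ; exact: linear_spanZ.
pose k v : Qv R v -> C := if v \in S then h v else @unramified R v.
have kE p : finite_place p \notin S -> k (finite_place p) = \1_(Zp p).
  by rewrite /k => /negbTE ->.
apply: linear_span_gen; exists k; split.
- move=> v; rewrite /k; case: ifP => // _.
  exact: local_bruhat_schwartz_unramified.
- apply: (@sub_finite_set _ _ (finite_place @^-1` [set` S])).
    by move=> p /= kp; apply: contrapT => /negP pS; apply/kp/kE.
  apply: finite_preimage; last exact: finite_fset.
  by move=> p q _ _ [].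
- apply/funext => x; rewrite (adelic_tensorE _ S0 kE).
  congr (_ * _); rewrite -[adele_proj x]/(trunc S (sval x)) !tensor_trunc.
  by apply: eq_big_seq => v vS; rewrite /k vS.
Qed.

(** S collects the places where one of the finitely many pure tensors involved
    has a factor that is not 1_{Z_p}. Having all larger T as well lets two
    functions be brought to the same level. *)
Lemma adelic_bruhat_schwartzE f : @adelic_bruhat_schwartz R f ->
  exists2 S, infty \in S & forall T, (S `<=` T)%fset ->
    exists2 s, @bruhat_schwartz R T s & f = adelic_extension s.
Proof.
move: f; apply: linear_span_ind.
- exists [fset infty]%fset; first exact: fset11.
  move=> T _; exists 0; first exact: bruhat_schwartz0.
  by rewrite adelic_extension0.
- move=> f g [S S0 fS] [T T0 gT]; exists (S `|` T)%fset.
    by rewrite inE S0.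
  move=> U; rewrite fsubUset => /andP[/fS[s sP ->] /gT[t tP ->]].
  by exists (s + t); [exact: bruhat_schwartzD|rewrite adelic_extensionD].
- move=> a f [S S0 fS]; exists S => // T /fS[s sP ->].
  by exists (a *: s); [exact: bruhat_schwartzZ|rewrite adelic_extensionZ].
move=> _ [h [hP /places_above[S S0 SE] ->]]; exists S => // T ST.
exists (tensor T h); first exact: bruhat_schwartz_tensor.
apply/funext => x; apply: adelic_tensorE; first exact: (fsubsetP ST).
move=> p pT; apply: contrapT => /SE pS; move/negP: pT; apply.
exact: (fsubsetP ST).
Qed.

Lemma adelic_bruhat_schwartz_algebra :
  is_algebra (function_algebra (@adelic_bruhat_schwartz R)).
Proof.
apply: function_algebraP.
- exact: linear_span0.
- by move=> f g; exact: linear_spanD.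
- by move=> a f; exact: linear_spanZ.
move=> f g /adelic_bruhat_schwartzE[S S0 fS] /adelic_bruhat_schwartzE[T T0 gT].
have [s sP ->] := fS _ (fsubsetUl S T); have [t tP ->] := gT _ (fsubsetUr S T).
rewrite -adelic_extensionM; apply: adelic_extension_bruhat_schwartz.
  by rewrite inE S0.
exact: bruhat_schwartzM.
Qed.

End adelic.

(** * The stalk at the generic point *)

(** The axioms of an algebra only bear on members, so they are inherited by the
    image of an algebra under a map that preserves the operations. *)
Lemma algebra_transport (K : comNzRingType) (A B : raw_algebra K)
    (G : carrier B -> carrier A) : is_algebra B ->
  (forall c, amem c <-> exists2 f, amem f & c = G f) ->
  azero = G azero ->
  (forall f, amem f -> aopp (G f) = G (aopp f)) ->
  (forall f g, amem f -> amem g -> aadd (G f) (G g) = G (aadd f g)) ->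
  (forall a f, amem f -> ascale a (G f) = G (ascale a f)) ->
  (forall f g, amem f -> amem g -> amul (G f) (G g) = G (amul f g)) ->
  is_algebra A.
Proof.
move=> [B0 BN BD BZ BM addA addC add0 addN scA sc1 scDr scDl mA mC mDl scAl].
move=> AG G0 GN GD GZ GM; split.
- by apply/AG; exists azero.
- move=> _ /AG[f fB ->]; rewrite GN//.
  by apply/AG; exists (aopp f); [exact: BN|].
- move=> _ _ /AG[f fB ->] /AG[g gB ->]; rewrite GD//.
  by apply/AG; exists (aadd f g); [exact: BD|].
- move=> a _ /AG[f fB ->]; rewrite GZ//.
  by apply/AG; exists (ascale a f); [exact: BZ|].
- move=> _ _ /AG[f fB ->] /AG[g gB ->]; rewrite GM//.
  by apply/AG; exists (amul f g); [exact: BM|].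
- move=> _ _ _ /AG[f fB ->] /AG[g gB ->] /AG[h hB ->].
  have fg := BD _ _ fB gB; have gh := BD _ _ gB hB.
  by rewrite (GD g h)// (GD f g)// GD// GD// addA.
- by move=> _ _ /AG[f fB ->] /AG[g gB ->]; rewrite !GD// addC.
- by move=> _ /AG[f fB ->]; rewrite G0 GD// add0.
- by move=> _ /AG[f fB ->]; rewrite GN// GD ?addN// ?G0//; exact: BN.
- move=> a b _ /AG[f fB ->]; have bf := BZ b _ fB.
  by rewrite (GZ b)// !GZ// scA.
- by move=> _ /AG[f fB ->]; rewrite GZ// sc1.
- move=> a _ _ /AG[f fB ->] /AG[g gB ->].
  have fg := BD _ _ fB gB; have af := BZ a _ fB; have ag := BZ a _ gB.
  by rewrite (GD f g)// !GZ// GD// scDr.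
- move=> a b _ /AG[f fB ->]; have af := BZ a _ fB; have bf := BZ b _ fB.
  by rewrite !GZ// GD// scDl.
- move=> _ _ _ /AG[f fB ->] /AG[g gB ->] /AG[h hB ->].
  have fg := BM _ _ fB gB; have gh := BM _ _ gB hB.
  by rewrite (GM g h)// (GM f g)// GM// GM// mA.
- by move=> _ _ /AG[f fB ->] /AG[g gB ->]; rewrite !GM// mC.
- move=> _ _ _ /AG[f fB ->] /AG[g gB ->] /AG[h hB ->].
  have fg := BD _ _ fB gB; have fh := BM _ _ fB hB; have gh := BM _ _ gB hB.
  by rewrite (GD f g)// !GM// GD// mDl.
- move=> a _ _ /AG[f fB ->] /AG[g gB ->].
  have fg := BM _ _ fB gB; have af := BZ a _ fB.
  by rewrite GZ// !GM// GZ// scAl.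
Qed.

Section generic_stalk.
Variable R : realType.
Local Notation C := R[i].
Local Notation F := (schwartz_sheaf R).
Local Notation eta := generic_point.
Local Notation ABS := (@adelic_bruhat_schwartz R).
Implicit Types (U V W : opens SpecZ).

Definition adelic_value (g : local_section F) : adele R -> C :=
  @adelic_extension R (places_of (domain g)) (section_on g).

Lemma adelic_extension_restr U W (WU : W `<=` U)
    (s : semilocal R (places_of U) -> C) : opens_set W eta ->
  adelic_extension (restr F WU s) = adelic_extension s.
Proof.
move=> We; have W0 : W !=set0 by exists eta.
have U0 : U !=set0 by exists eta; exact: WU.
rewrite /= (schwartz_restrE _ (places_of_sub WU W0))// adelic_extension_gamma//.
exact: infty_in.
Qed.

(** Sections with the same adelic extension already agree on the intersection of
    their domains, because adelic extension is injective there. *)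
Lemma same_germE (g h : local_section F) :
  opens_set (domain g) eta -> opens_set (domain h) eta ->
  same_germ eta g h <-> adelic_value g = adelic_value h.
Proof.
move=> ge he; split=> [[W [Wg [Wh [We gh]]]]|gh].
  rewrite /adelic_value -(adelic_extension_restr Wg)//.
  by rewrite -(adelic_extension_restr Wh)// gh.
exists (opensI (domain g) (domain h)), (opensIl _ _), (opensIr _ _).
split; first by split.
by apply: adelic_extension_inj; rewrite !adelic_extension_restr//.
Qed.

(** The inverse of the isomorphism from the stalk to the adelic functions. *)
Definition germ_of (f : adele R -> C) : carrier (stalk F eta) :=
  [set h | local_section_at eta h /\ adelic_value h = f].

Lemma germE U (s : carrier (sections F U)) : opens_set U eta ->
  germ eta s = germ_of (@adelic_extension R (places_of U) s).
Proof.
move=> Ue; apply/seteqP; split=> h [hat]; have [he _] := hat.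
  by move=> /same_germE -/(_ Ue he) sh; split.
by move=> hs; split=> //; apply/same_germE => //; exact: esym.
Qed.

Lemma germ_of_nonempty f : ABS f -> exists g, germ_of f g.
Proof.
move=> /adelic_bruhat_schwartzE[S S0 fS].
have SU : (S `<=` places_of (complement_of S))%fset by rewrite complement_ofK.
have [s sP fE] := fS _ SU.
exists (@LocalSection _ _ F (complement_of S) s); split=> //; split.
  exact: generic_complement.
rewrite /= schwartz_sectionsE//; exists eta; exact: generic_complement.
Qed.

Lemma germ_of_inj f g : ABS f -> germ_of f = germ_of g -> f = g.
Proof.
move=> /germ_of_nonempty[h hf] fg; move: (hf); rewrite fg => -[_ <-].
by case: hf.
Qed.

Lemma adelic_bruhat_schwartz_value f g : germ_of f g -> ABS f.
Proof.
move=> [[ge +] <-]; rewrite /= schwartz_sectionsE; last by exists eta.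
apply: adelic_extension_bruhat_schwartz; apply: infty_in; by exists eta.
Qed.

Lemma stalk_mem (c : carrier (stalk F eta)) :
  amem c <-> exists2 f, ABS f & c = germ_of f.
Proof.
split=> [[U [s [Ue sP ->]]]|[f fP ->]].
  rewrite germE//; exists (@adelic_extension R (places_of U) s) => //.
  by apply: (@adelic_bruhat_schwartz_value _ (LocalSection s)).
have [[U s] gf] := germ_of_nonempty fP; have [[Ue sP] fE] := gf.
by exists U, s; split=> //; rewrite germE// -fE.
Qed.

Lemma stalk_zero : azero = germ_of 0.
Proof. by rewrite /= germE// adelic_extension0. Qed.

Lemma stalk_opp f : ABS f ->
  aopp (germ_of f : carrier (stalk F eta)) = germ_of (- f).
Proof.
move=> /germ_of_nonempty[g gf]; apply/seteqP; split=> k /=.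
  move=> [h [[he _] hf]]; rewrite germE// => -[kat kE]; split=> //.
  by rewrite kE -hf adelic_extensionN.
move=> [kat kf]; exists g => //; have [[ge _] gE] := gf; rewrite germE//.
by split=> //; rewrite kf -gE adelic_extensionN.
Qed.

Lemma stalk_scale a f : ABS f ->
  ascale a (germ_of f : carrier (stalk F eta)) = germ_of (a *: f).
Proof.
move=> /germ_of_nonempty[g gf]; apply/seteqP; split=> k /=.
  move=> [h [[he _] hf]]; rewrite germE// => -[kat kE]; split=> //.
  by rewrite kE -hf adelic_extensionZ.
move=> [kat kf]; exists g => //; have [[ge _] gE] := gf; rewrite germE//.
by split=> //; rewrite kf -gE adelic_extensionZ.
Qed.

Lemma stalk_add f g : ABS f -> ABS g ->
  aadd (germ_of f : carrier (stalk F eta)) (germ_of g) = germ_of (f + g).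
Proof.
move=> /germ_of_nonempty[u uf] /germ_of_nonempty[v vg].
apply/seteqP; split=> k /=.
  move=> [s [t [W [Ws [Wt [[_ sf] [_ tg] We]]]]]].
  rewrite germE// => -[kat kE]; split=> //.
  by rewrite kE /= adelic_extensionD !adelic_extension_restr// -sf -tg.
move=> [kat kf]; have [[ue _] uE] := uf; have [[ve _] vE] := vg.
exists u, v, (opensI (domain u) (domain v)), (opensIl _ _), (opensIr _ _).
split=> //; rewrite germE//; split=> //.
by rewrite kf /= adelic_extensionD !adelic_extension_restr// -uE -vE.
Qed.

Lemma stalk_mul f g : ABS f -> ABS g ->
  amul (germ_of f : carrier (stalk F eta)) (germ_of g) = germ_of (f * g).
Proof.
move=> /germ_of_nonempty[u uf] /germ_of_nonempty[v vg].
apply/seteqP; split=> k /=.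
  move=> [s [t [W [Ws [Wt [[_ sf] [_ tg] We]]]]]].
  rewrite germE// => -[kat kE]; split=> //.
  by rewrite kE /= adelic_extensionM !adelic_extension_restr// -sf -tg.
move=> [kat kf]; have [[ue _] uE] := uf; have [[ve _] vE] := vg.
exists u, v, (opensI (domain u) (domain v)), (opensIl _ _), (opensIr _ _).
split=> //; rewrite germE//; split=> //.
by rewrite kf /= adelic_extensionM !adelic_extension_restr// -uE -vE.
Qed.

Lemma stalk_algebra : is_algebra (stalk F eta).
Proof.
apply: (@algebra_transport _ _ (function_algebra ABS) germ_of).
- exact: adelic_bruhat_schwartz_algebra.
- exact: stalk_mem.
- exact: stalk_zero.
- exact: stalk_opp.
- exact: stalk_add.
- exact: stalk_scale.
- exact: stalk_mul.
Qed.

Definition stalk_function (c : carrier (stalk F eta)) : adele R -> C :=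
  xget 0 [set f | ABS f /\ c = germ_of f].

Lemma germ_ofK f : ABS f -> stalk_function (germ_of f) = f.
Proof.
move=> fP; apply: xget_unique => // g [gP gf].
by apply: germ_of_inj => //.
Qed.

Lemma stalk_isomorphism : algebra_isomorphism
  (A := stalk F eta) (B := function_algebra ABS) stalk_function.
Proof.
have [AB0 ABN ABD ABZ ABM _ _ _ _ _ _ _ _ _ _ _ _] :=
  adelic_bruhat_schwartz_algebra R.
split.
- exact: stalk_algebra.
- exact: adelic_bruhat_schwartz_algebra.
- split.
  + by move=> _ /stalk_mem[f fP ->]; rewrite germ_ofK.
  + move=> _ _ /stalk_mem[f fP ->] /stalk_mem[g gP ->].
    by rewrite stalk_add// !germ_ofK//; exact: ABD.
  + move=> a _ /stalk_mem[f fP ->].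
    by rewrite stalk_scale// !germ_ofK//; exact: ABZ.
  + move=> _ _ /stalk_mem[f fP ->] /stalk_mem[g gP ->].
    by rewrite stalk_mul// !germ_ofK//; exact: ABM.
- split.
  + by move=> _ /stalk_mem[f fP ->]; rewrite germ_ofK.
  + move=> c d; rewrite !inE => /stalk_mem[f fP ->] /stalk_mem[g gP ->].
    by rewrite !germ_ofK// => ->.
  + move=> f fP; exists (germ_of f); last by rewrite germ_ofK.
    by apply/stalk_mem; exists f.
Qed.

Lemma stalk_function_germ U (f : carrier (sections F U)) :
  opens_set U eta -> amem f -> stalk_function (germ eta f) = adelic_extension f.
Proof.
move=> Ue fP; rewrite germE// germ_ofK//.
by apply: (@adelic_bruhat_schwartz_value _ (LocalSection f)).
Qed.

End generic_stalk.

(** * Global sections *)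

Section global_sections.
Variable R : realType.
Local Notation C := R[i].

Lemma places_ofT : places_of (opensT SpecZ) = [fset infty]%fset.
Proof.
apply/fsetP => -[p|]; last by rewrite infty_in ?inE//; exact: SpecZ_neq0.
rewrite inE /=; apply/negP => /(in_places_of _ SpecZ_neq0); exact.
Qed.

Lemma gamma_isomorphism (S T : {fset place}) (ST : (S `<=` T)%fset) :
  infty \in S -> T = S ->
  algebra_isomorphism (A := function_algebra (@bruhat_schwartz R S))
    (B := function_algebra (@bruhat_schwartz R T)) (gamma ST).
Proof.
move=> S0 TS; subst T.
split; [exact: bruhat_schwartz_algebra|exact: bruhat_schwartz_algebra| |].
  split=> /= [f|f g|a f|f g].
  - exact: gamma_bruhat_schwartz.
  - by rewrite gammaD.
  - by rewrite gammaZ.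
  - by rewrite gammaM.
split=> [f|f g _ _|f fP] /=; first exact: gamma_bruhat_schwartz.
  exact: gamma_inj.
by exists f => //; rewrite gamma_id.
Qed.

Lemma schwartz_function_algebra : is_algebra (function_algebra (@schwartz R)).
Proof.
apply: function_algebraP.
- exact: schwartz0.
- exact: schwartzD.
- exact: schwartz_cstM.
- exact: schwartzM.
Qed.

Let at_infty (f : R -> C) : semilocal R [fset infty]%fset -> C :=
  fun x => f (x [` fset11 infty]%fset).

Lemma tensor_infty (h : forall v, Qv R v -> C) :
  tensor [fset infty]%fset h = at_infty (h infty).
Proof. by apply/funext => x; rewrite /tensor big_fset1. Qed.

Lemma schwartz_bruhat_schwartz : algebra_isomorphism
  (A := function_algebra (@schwartz R))
  (B := function_algebra (@bruhat_schwartz R [fset infty]%fset)) at_infty.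
Proof.
have mem f : schwartz f -> bruhat_schwartz (at_infty f).
  move=> fP; pose h v : Qv R v -> C :=
    match v with Some p => @unramified R (Some p) | None => f end.
  rewrite -[f]/(h infty) -tensor_infty.
  apply: bruhat_schwartz_tensor => -[p|//].
  exact: (local_bruhat_schwartz_unramified R (Some p)).
split; [exact: schwartz_function_algebra|exact: bruhat_schwartz_algebra| |].
  by split.
split=> [//|f g _ _ /= fg|].
  apply/funext => a; pose X : point R := fun v =>
    match v with Some p => 0 : Qv R (Some p) | None => a end.
  exact: (congr1 (@^~ (trunc [fset infty]%fset X)) fg).
apply: bruhat_schwartz_ind => [|_ _ [f fP <-] [g gP <-]|a _ [f fP <-]|h hP].
- by exists 0 => //; exact: schwartz0.
- by exists (f + g) => //; exact: schwartzD.
- by exists (a *: f) => //; exact: schwartz_cstM.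
- by exists (h infty); [exact (hP infty)|rewrite tensor_infty].
Qed.

End global_sections.

Theorem proposition5p2 (R : realType) :
  [/\ is_sheaf_of_algebras (schwartz_sheaf R),
      exists Phi : carrier (stalk (schwartz_sheaf R) generic_point) ->
                   (adele R -> R[i]),
        algebra_isomorphism
          (A := stalk (schwartz_sheaf R) generic_point)
          (B := function_algebra (@adelic_bruhat_schwartz R)) Phi /\
        forall (U : opens SpecZ) (f : carrier (sections (schwartz_sheaf R) U)),
          opens_set U generic_point -> amem f ->
          Phi (germ generic_point f) = adelic_extension f
    & algebra_isomorphism
          (A := function_algebra (@bruhat_schwartz R [fset infty]%fset))
          (B := sections (schwartz_sheaf R) (opensT SpecZ))
          (gamma (places_of_infty SpecZ_neq0)) /\
      algebra_isomorphism
          (A := function_algebra (@schwartz R))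
          (B := function_algebra (@bruhat_schwartz R [fset infty]%fset))
          (fun f x => f (x [` fset11 infty]%fset)) ].
Proof.
split; first exact: schwartz_is_sheaf.
  exists (@stalk_function R); split; first exact: stalk_isomorphism.
  exact: stalk_function_germ.
split; last exact: schwartz_bruhat_schwartz.
rewrite /= schwartz_sectionsE; last exact: SpecZ_neq0.
by apply: gamma_isomorphism; [exact: fset11|exact: places_ofT].
Qed.
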